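(* The set of valid formulas of $\mathrm{SL}( *,-\!*,\mathrm{ls})$ (formulas satisfied by every memory state) is not recursively enumerable.
   Context: Fix a countably infinite set $\mathrm{PVAR}$ of program variables and a countably infinite set $\mathrm{LOC}$ of locations (e.g. $\mathbb{N}$). A memory state is a pair $(s,h)$ where $s:\mathrm{PVAR}\to\mathrm{LOC}$ (the store) and $h$ is a partial function $\mathrm{LOC}\to\mathrm{LOC}$ with finite domain $\mathrm{dom}(h)$ (the heap). Heaps $h_1,h_2$ are disjoint if $\mathrm{dom}(h_1)\cap\mathrm{dom}(h_2)=\emptyset$; then $h_1+h_2$ denotes their union. Formulas of $\mathrm{SL}( *,-\!*,\mathrm{ls})$ are built from atomic formulas $x=y$, $x\hookrightarrow y$, $\mathrm{ls}(x,y)$, $\mathrm{emp}$ (with $x,y\in\mathrm{PVAR}$) using $\neg$, $\wedge$, $*$ and $-\!*$. Semantics: $(s,h)\models x=y$ iff $s(x)=s(y)$; $(s,h)\models\mathrm{emp}$ iff $\mathrm{dom}(h)=\emptyset$; $(s,h)\models x\hookrightarrow y$ iff $s(x)\in\mathrm{dom}(h)$ and $h(s(x))=s(y)$; $(s,h)\models\mathrm{ls}(x,y)$ iff either ($\mathrm{dom}(h)=\emptyset$ and $s(x)=s(y)$) or $h=\{l_0\mapsto l_1,\dots,l_{n-1}\mapsto l_n\}$ with $n\ge 1$, $l_0=s(x)$, $l_n=s(y)$ and $l_0,\dots,l_n$ pairwise distinct; Boolean connectives as usual; $(s,h)\models\varphi_1*\varphi_2$ iff there are disjoint $h_1,h_2$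 with $h=h_1+h_2$, $(s,h_1)\models\varphi_1$, $(s,h_2)\models\varphi_2$; $(s,h)\models\varphi_1-\!*\varphi_2$ iff for every heap $h_1$ disjoint from $h$ with $(s,h_1)\models\varphi_1$ we have $(s,h+h_1)\models\varphi_2$. *)

(* Defs.v *)
From HB Require Import structures.
From mathcomp Require Import all_boot.
From mathcomp Require Import finmap.
From mathcomp Require Import zify.

Set Implicit Arguments.
Unset Strict Implicit.
Unset Printing Implicit Defensive.

Local Open Scope nat_scope.

Notation PVAR := nat (only parsing).
Notation LOC := nat (only parsing).

Definition store : Type := PVAR -> LOC.
Definition heap : Type := {fmap LOC -> LOC}.

Definition hdisj (h1 h2 : heap) : bool := [disjoint domf h1 & domf h2]%fset.

Inductive form : Type :=
| FEq   of PVAR & PVAR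
| FPto  of PVAR & PVAR
| FLs   of PVAR & PVAR
| FEmp
| FNeg  of form
| FAnd  of form & form
| FStar of form & form
| FWand of form & form.

(* h = {l 0 |-> l 1, ..., l (n-1) |-> l n} with l 0, ..., l n pairwise
   distinct; values of l beyond n are irrelevant. *)
Definition is_path_heap (h : heap) (n : nat) (l : nat -> LOC) : Prop :=
  (forall i j, i <= n -> j <= n -> l i = l j -> i = j) /\
  (forall a b : LOC,
     h.[? a]%fmap = Some b <-> exists2 i, i < n & a = l i /\ b = l i.+1).

Definition sat_ls (s : store) (h : heap) (x y : PVAR) : Prop :=
  (domf h = fset0 /\ s x = s y) \/
  (exists (n : nat) (l : nat -> LOC),
     [/\ 1 <= n, l 0 = s x, l n = s y & is_path_heap h n l]).

Fixpoint sat (s : store) (h : heap) (phi : form) {struct phi} : Prop :=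
  match phi with
  | FEq x y => s x = s y
  | FPto x y => h.[? s x]%fmap = Some (s y)
  | FLs x y => sat_ls s h x y
  | FEmp => domf h = fset0
  | FNeg p => ~ sat s h p
  | FAnd p q => sat s h p /\ sat s h q
  | FStar p q => exists h1 h2 : heap,
      [/\ hdisj h1 h2, h = (h1 + h2)%fset, sat s h1 p & sat s h2 q]
  | FWand p q => forall h1 : heap,
      hdisj h h1 -> sat s h1 p -> sat s (h + h1)%fset q
  end.

Definition valid (phi : form) : Prop :=
  forall (s : store) (h : heap), sat s h phi.

(* Kleene's schemes, indexed by arity. *)
Inductive recf : nat -> Type :=
| RZero n : recf n
| RSucc : recf 1
| RProj n (i : 'I_n) : recf n
| RComp k n (f : recf k) (g : 'I_k -> recf n) : recf n
| RPrec n (f : recf n) (g : recf n.+2) : recf n.+1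
| RMu n (f : recf n.+1) : recf n.

(* [graph f v y] means that f converges on v with value y.  Primitive
   recursion and minimization both act on the first argument:
     h(0, v) = f(v),  h(m+1, v) = g(m, h(m, v), v);
     mu f (v) = the least y with f(y, v) = 0, where f(z, v) must converge
     for every z < y. *)
Fixpoint graph (n : nat) (f : recf n) {struct f} :
    n.-tuple nat -> nat -> Prop :=
  match f in recf n return n.-tuple nat -> nat -> Prop with
  | RZero n => fun _ y => y = 0
  | RSucc => fun v y => y = (thead v).+1
  | RProj n i => fun v y => y = tnth v i
  | RComp k n f g => fun v y =>
      exists2 w : k.-tuple nat,
        (forall i, graph (g i) v (tnth w i)) & graph f w y
  | RPrec n f g => fun v y =>
      let u : n.-tuple nat := [tuple of behead v] in
      let fix prec (m z : nat) {struct m} : Prop :=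
        match m with
        | 0 => graph f u z
        | m'.+1 =>
            exists2 t, prec m' t & graph g [tuple of m' :: t :: u] z
        end in
      prec (thead v) y
  | RMu n f => fun v y =>
      graph f [tuple of y :: v] 0 /\
      (forall z, z < y -> exists t, graph f [tuple of z :: v] t.+1)
  end.

(* A set of natural numbers is r.e. iff it is the domain of a unary partial
   recursive function. *)
Definition nat_re (A : nat -> Prop) : Prop :=
  exists f : recf 1, forall x, A x <-> exists y, graph f [tuple x] y.

(* Cantor's pairing bijection nat * nat -> nat: (a+b)(a+b+1)/2 + b. *)
Definition cpair (a b : nat) : nat := 'C((a + b).+1, 2) + b.

Fixpoint gnum (phi : form) : nat :=
  match phi with
  | FEq x y => cpair 0 (cpair x y)
  | FPto x y => cpair 1 (cpair x y)
  | FLs x y => cpair 2 (cpair x y)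
  | FEmp => cpair 3 0
  | FNeg p => cpair 4 (gnum p)
  | FAnd p q => cpair 5 (cpair (gnum p) (gnum q))
  | FStar p q => cpair 6 (cpair (gnum p) (gnum q))
  | FWand p q => cpair 7 (cpair (gnum p) (gnum q))
  end.

Lemma cpair_inj a b c d : cpair a b = cpair c d -> a = c /\ b = d.
Proof.
rewrite /cpair => E.
suff Es : a + b = c + d by move: E; rewrite Es; lia.
have key m n k : m < n -> k <= m -> 'C(m.+1, 2) + k < 'C(n.+1, 2).
  move=> lt_mn le_km; apply: (@leq_trans 'C(m.+2, 2)).
    by rewrite (binS m.+1 1) bin1; lia.
  exact: leq_bin2l.
case: (ltngtP (a + b) (c + d)) => // lt.
- have := key _ _ b lt (leq_addl _ _); lia.
- have := key _ _ d lt (leq_addl _ _); lia.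
Qed.

Lemma gnum_inj : injective gnum.
Proof.
elim=> [x y|x y|x y||p IHp|p IHp q IHq|p IHp q IHq|p IHp q IHq]
  [x' y'|x' y'|x' y'||p'|p' q'|p' q'|p' q'] //= /cpair_inj [] // _;
  try by move=> /cpair_inj [-> ->].
- by move/IHp ->.
- by move/cpair_inj => [/IHp -> /IHq ->].
- by move/cpair_inj => [/IHp -> /IHq ->].
- by move/cpair_inj => [/IHp -> /IHq ->].
Qed.

Definition form_re (A : form -> Prop) : Prop :=
  nat_re (fun n => exists2 phi, n = gnum phi & A phi).

(* Main.v *)
(** The domain of a partial recursive function f cannot be the set of codes of
    valid formulas, by diagonalization: to every unary partial recursive g one
    associates a formula A such that the formula ~ (A /\ In (n+1)), whose code
    is a recursive function d(code of A, n), is valid iff g diverges at n.  For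
    g(a) = f(d(a, a)) and n the code of A, this formula is valid iff it is not.

    To find A, a converging computation of g is represented by a finite set of
    facts "g'(v) = y" about the subterms g' of g, each of which follows from
    the others by a rule that only speaks about equality, successor and zero of
    the entries of a few facts.  A fact is stored in the heap as a chain, whose
    entries are the in-degrees of certain nodes of the chain.

    A first-order variable x is simulated by a cell s x -> c added with the
    magic wand; ls tests the equality of the contents of two such cells.  The
    in-degrees of two nodes a, b are compared by cutting the edges into a and
    then adding edges that map the former predecessors of a injectively to
    those of b. *)

Require Import Defs.
From HB Require Import structures.
From mathcomp Require Import all_boot finmap zify.
From Stdlib Require Import Classical.

Set Implicit Arguments.
Unset Strict Implicit.
Unset Printing Implicit Defensive.

Local Open Scope nat_scope.
Local Open Scope fmap_scope.

(** * Heaps and derived connectives *)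

(** The rules only demand support: a flagged fact must be the conclusion of some rule whose premises
    are facts again. This admits circular justifications and junk in the heap, but is harmless.
    Going from a conclusion to its premises leads to a subterm of g, to a smaller counter, or from a
    minimization to its auxiliary facts; so flagged facts of a closed set are true, while a
    converging computation provides a finite closed set.

    A heap is a finite partial function: a node has at most one successor but arbitrarily many
    predecessors. Hence chains hold the tuples and in-degrees hold the numbers, shifted by one
    because the chain itself enters the node. The comparison of in-degrees contains the only
    septraction that adds more than one cell; the added heap is an injection between sets of
    predecessors. Comparing with a slack of 0 or 1 yields both equality and successor.

    The formula A is fixed, and n enters only through In(n+1), an (n+1)-fold separating conjunction,
    whose code arises by iterating the pairing function. *)

Lemma hdisjP (h1 h2 : heap) :
  hdisj h1 h2 <-> forall x, h1.[? x] = None \/ h2.[? x] = None.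
Proof.
rewrite /hdisj; split.
  move=> /fdisjointP d x; case: fndP => [i|ni]; last by left.
  by right; rewrite not_fnd // d.
move=> H; apply/fdisjointP => x xi; case: (H x) => E; first by rewrite (in_fnd xi) in E.
by rewrite -fndSome E.
Qed.

Lemma fnd_hadd (h1 h2 : heap) x : hdisj h1 h2 ->
  (h1 + h2)%fset.[? x] = if h1.[? x] is Some y then Some y else h2.[? x].
Proof.
move=> /hdisjP /(_ x) d; rewrite fnd_cat; case: ifP => xi; last first.
  rewrite [in RHS](not_fnd (negbT xi)).
  by case: (h1.[? x]).
by case: d => [->|E] //; rewrite -fndSome E in xi.
Qed.

Definition mkheap (f : nat -> nat) (l : seq nat) : heap :=
  foldr (fun k (h : heap) => h.[k <- f k]) [fmap] l.

Lemma fnd_mkheap f l x : (mkheap f l).[? x] = if x \in l then Some (f x) else None.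
Proof.
elim: l => [|k l IH] /=; first by rewrite fnd_fmap0.
by rewrite fnd_set in_cons IH; case: eqP => [->|].
Qed.

Definition cell (a b : nat) : heap := [fmap].[a <- b].

Lemma fnd_cell a b x : (cell a b).[? x] = if x == a then Some b else None.
Proof. by rewrite /cell fnd_set fnd_fmap0. Qed.

Lemma hdisj_cell (h : heap) a b : hdisj h (cell a b) <-> h.[? a] = None.
Proof.
rewrite hdisjP; split=> [/(_ a)|E x].
  by rewrite fnd_cell eqxx; case.
by rewrite fnd_cell; case: eqP => [->|_]; [left|right].
Qed.

Lemma hadd_cell (h : heap) a b : h.[? a] = None -> (h + cell a b)%fset = h.[a <- b].
Proof.
move=> E; apply/fmapP => x; rewrite fnd_hadd; last by apply/hdisj_cell.
by rewrite fnd_cell fnd_set; case: eqP => [->|_]; [rewrite E | case: fnd].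
Qed.

Lemma size_domf1 (h : heap) :
  #|` domf h| = 1 <-> exists a b, h = cell a b.
Proof.
split=> [/eqP/cardfs1P[a E]|[a [b ->]]]; last first.
  by rewrite /cell dom_setf fsetU0 cardfs1.
have ai : a \in domf h by rewrite E in_fset1.
exists a, h.[ai]; apply/fmapP => x; rewrite fnd_cell; case: eqP => [->|n].
  exact: in_fnd.
by rewrite not_fnd // -[_ \notin h]/(x \notin domf h) E in_fset1; apply/eqP.
Qed.

Lemma domf_full (h : heap) (l : seq nat) : uniq l -> size l = #|` domf h| ->
  (forall x, x \in l -> h.[? x] <> None) ->
  forall x, h.[? x] <> None -> x \in l.
Proof.
move=> ul sl sub x nx.
have sub' : {subset l <= domf h}.
  by move=> y /sub; rewrite -fndSome; case: fnd.
have [|_ ->] := uniq_min_size ul sub'; first by rewrite sl.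
by rewrite -fndSome; case: fnd nx.
Qed.

Lemma size_domfE (h : heap) (l : seq nat) : uniq l ->
  (forall x, x \in l <-> h.[? x] <> None) -> #|` domf h| = size l.
Proof.
move=> ul H; apply/perm_size/uniq_perm => // x.
by apply/idP/idP => [|/H]; rewrite -fndSome; [rewrite H|]; case: fnd.
Qed.

Section Connectives.
Variable s : store.

Definition FTrue := FNeg (FAnd FEmp (FNeg FEmp)).
Definition FOr p q := FNeg (FAnd (FNeg p) (FNeg q)).
Definition FImp p q := FOr (FNeg p) q.
Definition FSept p q := FNeg (FWand p (FNeg q)).
(** Every heap satisfying [FPto x x] owns the cell [s x], so the wand is vacuous exactly if no such
    heap is disjoint from the current one. *)
Definition FAlloc x := FWand (FPto x x) (FNeg FTrue).
Definition FOne := FAnd (FNeg FEmp) (FNeg (FStar (FNeg FEmp) (FNeg FEmp))).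
Fixpoint FSize n := if n is n'.+1 then FStar FOne (FSize n') else FEmp.
Definition FBigAnd (l : seq form) := foldr FAnd FTrue l.
Definition FBigOr (l : seq form) := foldr FOr (FNeg FTrue) l.

Lemma sat_true h : sat s h FTrue.
Proof. by move=> /= []. Qed.

Lemma sat_and h p q : sat s h (FAnd p q) <-> sat s h p /\ sat s h q.
Proof. by []. Qed.

Lemma sat_neg h p : sat s h (FNeg p) <-> ~ sat s h p.
Proof. by []. Qed.

Lemma sat_or h p q : sat s h (FOr p q) <-> sat s h p \/ sat s h q.
Proof. by rewrite /=; split=> [|[]]; tauto. Qed.

Lemma sat_imp h p q : sat s h (FImp p q) <-> (sat s h p -> sat s h q).
Proof. by rewrite sat_or sat_neg; tauto. Qed.

Lemma sat_bigand (T : eqType) h (l : seq T) F :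
  sat s h (FBigAnd (map F l)) <-> forall x, x \in l -> sat s h (F x).
Proof.
elim: l => [|x l IH] /=; first by split=> // _ [].
rewrite IH; split=> [[H1 H2] y|H].
  by rewrite in_cons => /orP[/eqP ->|/H2].
by split=> [|y yl]; apply: H; rewrite in_cons ?eqxx ?yl ?orbT.
Qed.

Lemma sat_bigor (T : eqType) h (l : seq T) F :
  sat s h (FBigOr (map F l)) <-> exists2 x, x \in l & sat s h (F x).
Proof.
elim: l => [|x l IH].
  by split=> [[]|[]//]; apply: sat_true.
change (FBigOr (map F (x :: l))) with (FOr (F x) (FBigOr (map F l))).
rewrite sat_or IH; split=> [[H|[y yl H]]|[y]].
- by exists x; rewrite ?mem_head.
- by exists y; rewrite ?in_cons ?yl ?orbT.
by rewrite in_cons => /orP[/eqP ->|yl H]; [left|right; exists y].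
Qed.

(** A splitting is determined by the addresses that go to the left, so one predicate replaces the
    two existentially quantified heaps. *)
Lemma sat_star h p q : sat s h (FStar p q) <->
  exists P : pred nat, sat s (filterf h P) p /\ sat s (filterf h (predC P)) q.
Proof.
split=> [[h1 [h2 [d -> H1 H2]]]|[P [H1 H2]]].
  exists (fun x => h1.[? x] != None); split.
    suff -> : filterf (h1 + h2)%fset (fun x => h1.[? x] != None) = h1 by [].
    apply/fmapP => x; rewrite fnd_filterf fnd_hadd //.
    by case E: h1.[? x].
  set P := predC _; suff -> : filterf (h1 + h2)%fset P = h2 by [].
  apply/fmapP => x; rewrite fnd_filterf fnd_hadd // /P /= negbK.
  by have /hdisjP/(_ x) := d; case: h1.[? x] => //= a [//|->].
have d : hdisj (filterf h P) (filterf h (predC P)).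
  apply/hdisjP => x; rewrite !fnd_filterf /=.
  by case: (P x); [right|left].
exists (filterf h P), (filterf h (predC P)); split => //.
apply/fmapP => x; rewrite fnd_hadd // !fnd_filterf /=.
by case: (P x) => //=; case: h.[? x].
Qed.

Lemma sat_sept h p q : sat s h (FSept p q) <->
  exists h1, [/\ hdisj h h1, sat s h1 p & sat s (h + h1)%fset q].
Proof.
rewrite /=; split=> [H|[h1 [d H1 H2]] H]; last exact: (H h1).
apply: NNPP => N; apply: H => h1 d H1 H2.
by apply: N; exists h1.
Qed.

Lemma sat_alloc h x : sat s h (FAlloc x) <-> h.[? s x] <> None.
Proof.
rewrite /FAlloc /=; split=> [H E|H h1 /hdisjP/(_ (s x)) [//|->//]].
apply: (H (cell (s x) (s x))); last by case.
  exact/hdisj_cell.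
by rewrite fnd_cell eqxx.
Qed.

Lemma size_filterf (h : heap) P :
  #|` domf h| = #|` domf (filterf h P)| + #|` domf (filterf h (predC P))|.
Proof.
have sz Q : #|` domf (filterf h Q)| = size [seq x <- domf h | Q x].
  apply: size_domfE => [|x]; first by rewrite filter_uniq ?fset_uniq.
  rewrite mem_filter fnd_filterf -fndSome.
  by case: (Q x); case: fnd.
by rewrite !sz !size_filter count_predC.
Qed.

Lemma size_domf_gt0 (h : heap) : domf h <> fset0 <-> 0 < #|` domf h|.
Proof.
by rewrite cardfs_gt0; split=> [/eqP|/eqP].
Qed.

Lemma sat_one h : sat s h FOne <-> #|` domf h| = 1.
Proof.
rewrite /FOne; change (sat s h (FAnd ?p (FNeg ?q))) with (sat s h p /\ ~ sat s h q).
rewrite sat_star; split=> [[/size_domf_gt0 n0 N]|E].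
  have [a ad] : exists a, a \in domf h by apply/fset0Pn; rewrite -cardfs_gt0.
  case: (#|` domf h| =P 1) => // n1; case: N; exists (pred1 a).
  have E1 : #|` domf (filterf h (pred1 a))| = 1.
    rewrite (@size_domfE _ [:: a]) // => x; rewrite inE fnd_filterf /=.
    case: eqP => [->|] //; split=> // _.
    by rewrite (in_fnd ad).
  split; apply/size_domf_gt0; first by rewrite E1.
  by move: n0 n1; rewrite (size_filterf h (pred1 a)) E1; case: #|` _|.
split; first by apply/size_domf_gt0; rewrite E.
case=> P [/size_domf_gt0 P1 /size_domf_gt0 P2].
move: E P1 P2; rewrite (size_filterf h P).
by case: #|` _| => [|n] //; case: #|` _| => [|m] //; rewrite addnS.
Qed.

Lemma sat_size h n : sat s h (FSize n) <-> #|` domf h| = n.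
Proof.
elim: n h => [|n IH] h.
  change (domf h = fset0 <-> #|` domf h| = 0); have := size_domf_gt0 h.
  case: (domf h =P fset0) => [->|N [/(_ N) H _]]; first by rewrite cardfs0.
  by split=> // E; rewrite E in H.
change (FSize n.+1) with (FStar FOne (FSize n)).
rewrite sat_star; split=> [[P [/sat_one E1 /IH E2]]|E].
  by rewrite (size_filterf h P) E1 E2.
have [a ad] : exists a, a \in domf h by apply/fset0Pn; rewrite -cardfs_gt0 E.
exists (pred1 a); rewrite sat_one IH.
have E1 : #|` domf (filterf h (pred1 a))| = 1.
  rewrite (@size_domfE _ [:: a]) // => x; rewrite inE fnd_filterf /=.
  case: eqP => [->|] //; split=> // _.
  by rewrite (in_fnd ad).
by split=> //; move: E; rewrite (size_filterf h (pred1 a)) E1 => -[].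
Qed.

Lemma sat_sept_one h p q : sat s h (FSept (FAnd FOne p) q) <->
  exists a b, [/\ h.[? a] = None, sat s (cell a b) p & sat s h.[a <- b] q].
Proof.
rewrite sat_sept; split=> [[h1 [d [/sat_one/size_domf1[a [b E]] H1] H2]]|].
  move: d H1 H2; rewrite E => /hdisj_cell d H1 H2; exists a, b; split=> //.
  by rewrite hadd_cell in H2.
move=> [a [b [n H1 H2]]]; exists (cell a b); split; first exact/hdisj_cell.
  by split=> //; apply/sat_one/size_domf1; exists a, b.
by rewrite hadd_cell.
Qed.

(** [ls] describes the whole heap and leaves the length open. A path with n edges has exactly n
    cells, so [FSize n] fixes the length, and [FTrue] absorbs the rest of the heap. *)
Definition FReach n x z := FStar (FAnd (FLs x z) (FSize n)) FTrue.

Lemma path_heap_size h n l : is_path_heap h n l -> #|` domf h| = n.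
Proof.
move=> [inj H]; rewrite (@size_domfE _ [seq l i | i <- iota 0 n]).
- by rewrite size_map size_iota.
- rewrite map_inj_in_uniq ?iota_uniq // => i j; rewrite !mem_iota => Hi Hj.
  by apply: inj; lia.
move=> x; split=> [/mapP[i]|].
  rewrite mem_iota => Hi ->; have -> // : h.[? l i] = Some (l i.+1).
  by apply/H; exists i; [lia|].
case E: h.[? x] => [b|//] _; have [i Hi [-> _]] := (H x b).1 E.
by apply/mapP; exists i; rewrite // mem_iota; lia.
Qed.

Lemma sat_reach h n x z : 0 < n -> sat s h (FReach n x z) <->
  exists l : nat -> nat, [/\ l 0 = s x, l n = s z,
    forall i j, i <= n -> j <= n -> l i = l j -> i = j &
    forall i, i < n -> h.[? l i] = Some (l i.+1)].
Proof.
move=> n0; rewrite /FReach sat_star; split.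
  case=> P [[L /sat_size E] _]; case: L => [[E0]|[m [l [_ l0 lm pl]]]].
    by rewrite E0 cardfs0 in E; rewrite -E in n0.
  have mn : m = n by rewrite -E (path_heap_size pl).
  rewrite {}mn in lm pl; case: pl => inj H; exists l; split=> // i Hi.
  have : (filterf h P).[? l i] = Some (l i.+1) by apply/H; exists i.
  by rewrite fnd_filterf; case: (P _).
case=> l [l0 ln inj H]; exists (fun a => a \in [seq l i | i <- iota 0 n]).
set h1 := filterf _ _.
have pl : is_path_heap h1 n l.
  split=> // a b; rewrite fnd_filterf; split.
    case: ifP => // /mapP[i]; rewrite mem_iota => Hi ->.
    by rewrite H // => -[<-]; exists i.
  move=> [i Hi [-> ->]]; rewrite H //.
  by rewrite map_f // mem_iota.
split; last exact: sat_true.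
split; last by apply/sat_size/(path_heap_size pl).
by right; exists n, l.
Qed.

Lemma sat_reach2 h x z : sat s h (FReach 2 x z) <->
  exists a, [/\ h.[? s x] = Some a, h.[? a] = Some (s z),
                s x <> a, s x <> s z & a <> s z].
Proof.
rewrite sat_reach //; split=> [[l [l0 l2 inj H]]|[a [H1 H2 n1 n2 n3]]].
  exists (l 1); rewrite -l0 -l2 !H //; split=> // E.
  - by have := inj 0 1 isT isT E.
  - by have := inj 0 2 isT isT E.
  - by have := inj 1 2 isT isT E.
exists (fun i => nth (s z) [:: s x; a] i); split=> //.
  by move=> [|[|[|i]]] [|[|[|j]]] //= _ _; congruence.
by move=> [|[|i]].
Qed.

Lemma sat_reach3 h x z : sat s h (FReach 3 x z) <->
  exists a c, [/\ h.[? s x] = Some a, h.[? a] = Some c, h.[? c] = Some (s z) &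
    uniq [:: s x; a; c; s z]].
Proof.
rewrite sat_reach //; split=> [[l [l0 l2 inj H]]|[a [c [H1 H2 H3 u]]]].
  exists (l 1), (l 2); rewrite -l0 -l2 !H //; split=> //.
  rewrite -[X in uniq X]/[seq l i | i <- iota 0 4] map_inj_in_uniq // => i j.
  by rewrite !mem_iota => ? ?; apply: inj; lia.
exists (fun i => nth (s z) [:: s x; a; c] i); split=> //; last by move=> [|[|[|i]]].
move=> i j Hi Hj E; apply/eqP.
have E' k : k <= 3 -> nth (s z) [:: s x; a; c] k = nth 0 [:: s x; a; c; s z] k.
  by case: k => [|[|[|[|]]]].
by rewrite -(nth_uniq 0 _ _ u) // -!E' // E.
Qed.

End Connectives.

(** * Inference systems over tuples of numbers *)

(* In a constraint, x and y are indices of facts (0 is the conclusion of the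
   rule, the others are its premises) and i, j are indices of their entries. *)
Inductive constr :=
| CEq of nat & nat & nat & nat
| CSucc of nat & nat & nat & nat
| CZero of nat & nat
| CPos of nat & nat.

Definition constr_code c :=
  match c with
  | CEq x i y j => (0, x, i, y, j)
  | CSucc x i y j => (1, x, i, y, j)
  | CZero x i => (2, x, i, 0, 0)
  | CPos x i => (3, x, i, 0, 0)
  end.

Definition constr_decode t :=
  match t with
  | (0, x, i, y, j) => CEq x i y j
  | (1, x, i, y, j) => CSucc x i y j
  | (2, x, i, _, _) => CZero x i
  | (_, x, i, _, _) => CPos x i
  end.

Lemma constr_codeK : cancel constr_code constr_decode. Proof. by case. Qed.
HB.instance Definition _ := Equality.copy constr (can_type constr_codeK).

Definition rule := seq constr.
Definition clause : Type := nat * seq rule.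

Definition holds T (dat : T -> nat -> nat) (env : nat -> T) c :=
  match c with
  | CEq x i y j => dat (env x) i = dat (env y) j
  | CSucc x i y j => dat (env y) j = (dat (env x) i).+1
  | CZero x i => dat (env x) i = 0
  | CPos x i => 0 < dat (env x) i
  end.

Definition rule_holds T (dom : T -> Prop) dat p (r : rule) :=
  exists env : nat -> T, [/\ env 0 = p, forall i, dom (env i) &
    forall c, c \in r -> holds dat env c].

(* The entry t of a fact p acts as a flag: it is 0 iff the clause t applies. *)
Definition supported T (dom : T -> Prop) dat p (cls : seq clause) :=
  forall cl, cl \in cls -> dat p cl.1 = 0 ->
    exists2 r, r \in cl.2 & rule_holds dom dat p r.

Definition closed T (dom : T -> Prop) dat cls :=
  forall p, dom p -> supported dom dat p cls.

Definition facts_of c :=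
  match c with CEq x _ y _ | CSucc x _ y _ => maxn x y | CZero x _ | CPos x _ => x end.

Definition entries_of c :=
  match c with CEq _ i _ j | CSucc _ i _ j => maxn i j | CZero _ i | CPos _ i => i end.

Definition rule_facts (r : rule) := \max_(c <- r) facts_of c.
Definition rule_entries (r : rule) := \max_(c <- r) entries_of c.
Definition clause_facts (cls : seq clause) := \max_(cl <- cls) \max_(r <- cl.2) rule_facts r.
Definition clause_entries (cls : seq clause) :=
  \max_(cl <- cls) maxn cl.1 (\max_(r <- cl.2) rule_entries r).

(** * First-order quantification *)

Section FirstOrder.
Variables (s : store) (K : nat).
Hypothesis s_inj : forall i j, i <= K -> j <= K -> s i = s j -> i = j.
Hypothesis K_gt0 : 0 < K.

(* The value of the first-order variable x (1 < x <= K) is the content of the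
   cell s x.  The location s 1 is never allocated; s 0 is an ordinary location. *)
Definition hid l := l \in [seq s i | i <- iota 1 K].
(* Loops are excluded because ls cannot detect them. *)
Definition vis (h : heap) x y := [&& ~~ hid x, ~~ hid y, x != y & h.[? x] == Some y].

(** Variables are numbered by quantifier depth: [l] is the next one, and the cells from [s l] on are
    still free. Quantification adds hidden cells only, so [E] does not change under binders. *)
Definition st (h : heap) (E : rel nat) l :=
  [/\ 1 < l, h.[? s 1] = None, forall i, l <= i <= K -> h.[? s i] = None &
      forall x y, vis h x y = E x y].
Definition var (h : heap) x a := [/\ 1 < x <= K, h.[? s x] = Some a & ~~ hid a].

Lemma hid_s i : 0 < i <= K -> hid (s i).
Proof. by move=> Hi; rewrite /hid map_f // mem_iota; lia. Qed.

Lemma hidP l : hid l <-> exists2 i, 0 < i <= K & l = s i.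
Proof.
split=> [/mapP[i]|[i Hi ->]]; last exact: hid_s.
by rewrite mem_iota => Hi ->; exists i => //; lia.
Qed.

Lemma hid_neq x i : ~~ hid x -> 0 < i <= K -> (x == s i) = false /\ (s i == x) = false.
Proof.
move=> nx Hi; rewrite [_ == x]eq_sym; suff -> : (x == s i) = false by [].
by apply/negP => /eqP E; rewrite E hid_s in nx.
Qed.

Lemma var_lt h E l x a : st h E l -> var h x a -> 1 < x < l.
Proof.
move=> [_ _ F _] [Hx Ex _]; case: (ltnP x l) => [lt|le]; first lia.
by have /F := (introT andP (conj le (proj2 (andP Hx)))); rewrite Ex.
Qed.

Lemma st_set h E l c : l <= K -> st h E l -> st h.[s l <- c] E l.+1.
Proof.
move=> lK [l1 h1 F V]; split=> [||i Hi|x y]; first lia.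
- rewrite fnd_set; case: eqP => // /s_inj; lia.
- rewrite fnd_set; case: eqP => [/s_inj|_]; [lia | apply: F; lia].
rewrite -V /vis fnd_set; case: (boolP (hid x)) => //= nx.
by rewrite (hid_neq nx _).1 //; lia.
Qed.

Lemma var_set h E l c x a : st h E l -> l <= K -> var h x a -> var h.[s l <- c] x a.
Proof.
move=> S lK V; have Hx := var_lt S V; case: V => [Hx' Ex na]; split=> //.
by rewrite fnd_set; case: eqP => // /s_inj; lia.
Qed.

Lemma var_new h l c : 1 < l <= K -> ~~ hid c -> var h.[s l <- c] l c.
Proof. by move=> Hl nc; split=> //; rewrite fnd_set eqxx. Qed.

Definition FNotHid k := FBigAnd [seq FNeg (FPto k x) | x <- iota 1 K].
Definition FEx k p := FSept (FAnd FOne (FAnd (FAlloc k) (FNotHid k))) p.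
Definition FAll k p := FNeg (FEx k (FNeg p)).

Lemma sat_nothid (h : heap) k c : h.[? s k] = Some c ->
  sat s h (FNotHid k) <-> ~~ hid c.
Proof.
move=> Ek; rewrite sat_bigand; split=> [H|nc x]; last first.
  rewrite mem_iota /= Ek => Hx [E]; rewrite E hid_s // in nc; lia.
apply/negP => /hidP[i Hi E]; apply: (H i); first by rewrite mem_iota; lia.
by rewrite /= Ek E.
Qed.

Lemma sat_ex0 (h : heap) k p : h.[? s k] = None ->
  sat s h (FEx k p) <-> exists2 c, ~~ hid c & sat s h.[s k <- c] p.
Proof.
move=> n; rewrite sat_sept_one; split=> [[a [b [na [A B] C]]]|[c nc C]].
  move: A B => /sat_alloc; rewrite fnd_cell; case: eqP => // E _.
  move/(@sat_nothid _ _ b); rewrite E fnd_cell eqxx => /(_ erefl) nb.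
  by exists b.
exists (s k), c; split=> //; split; first by apply/sat_alloc; rewrite fnd_cell eqxx.
by apply/(@sat_nothid _ _ c) => //; rewrite fnd_cell eqxx.
Qed.

(** The meaning [P] of the body is required in every state with one more variable, not just in a
    particular extension of [h]; this lets nested quantifiers be translated by repeated
    application. *)
Lemma sat_ex h E l p (P : nat -> Prop) : st h E l -> l <= K ->
  (forall c h', ~~ hid c -> st h' E l.+1 -> var h' l c ->
     (forall x a, var h x a -> var h' x a) -> (sat s h' p <-> P c)) ->
  sat s h (FEx l p) <-> exists2 c, ~~ hid c & P c.
Proof.
move=> S lK H; have [l1 _ F _] := S.
rewrite sat_ex0; last by apply: F; lia.
have H' c : ~~ hid c -> (sat s h.[s l <- c] p <-> P c).
  move=> nc; apply: H => //; first exact: st_set.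
    by apply: var_new => //; lia.
  by move=> x a; apply: var_set S lK.
by split=> -[c nc /(H' c nc)]; exists c.
Qed.

Lemma sat_all h E l p (P : nat -> Prop) : st h E l -> l <= K ->
  (forall c h', ~~ hid c -> st h' E l.+1 -> var h' l c ->
     (forall x a, var h x a -> var h' x a) -> (sat s h' p <-> P c)) ->
  sat s h (FAll l p) <-> forall c, ~~ hid c -> P c.
Proof.
move=> S lK H; rewrite /FAll sat_neg.
rewrite (@sat_ex h E l _ (fun c => ~ P c) S lK); last first.
  by move=> c h' nc Sc Vc M; rewrite sat_neg (H c).
split=> [N c nc|A [c /A]//]; by apply: NNPP => nP; apply: N; exists c.
Qed.

(* Two distinct contents cannot both be linked to s 1 by a single new cell. *)
Definition FAeq x y :=
  FStar (FAnd (FSize 2) (FAnd (FAnd (FAlloc x) (FAlloc y))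
    (FSept (FAnd FOne FTrue) (FAnd (FReach 2 x 1) (FReach 2 y 1))))) FTrue.

Lemma sat_aeq h x y a b : x <> y -> var h x a -> var h y b ->
  sat s h (FAeq x y) <-> a = b.
Proof.
move=> nxy [Hx Ex na] [Hy Ey nb].
have neqs : s x <> s y by move/s_inj; lia.
have nas i : 0 < i <= K -> a <> s i by move=> Hi E; rewrite E hid_s in na.
have nbs i : 0 < i <= K -> b <> s i by move=> Hi E; rewrite E hid_s in nb.
rewrite /FAeq sat_star; split.
  case=> P []/sat_and[/sat_size sz /sat_and[/sat_and[/sat_alloc Ax /sat_alloc Ay]]] + _.
  move=> /sat_sept_one[m [n [nm _ /sat_and[/sat_reach2[a' [R1 R2 _ _ _]]
    /sat_reach2[b' [R3 R4 _ _ _]]]]]].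
  set h1 := filterf h P in sz Ax Ay nm R1 R2 R3 R4.
  have full : forall k, h1.[? k] <> None -> k \in [:: s x; s y].
    apply: domf_full; rewrite ?sz //.
      by rewrite /= inE andbT; apply/eqP.
    by move=> k; rewrite !inE => /orP[]/eqP->.
  have sub k c : h1.[? k] = Some c -> h.[? k] = Some c.
    by rewrite fnd_filterf; case: (P k).
  (* The content [u] is not hidden, hence not allocated in the two-cell heap, so a path through [u]
     to [s 1] must use the new cell [m]. *)
  have aux t u v : (0 < t <= K) -> h.[? s t] = Some u -> h1.[? s t] <> None ->
      h1.[m <- n].[? s t] = Some v -> h1.[m <- n].[? v] = Some (s 1) -> 
      ~~ hid u -> u = m.
    move=> Ht Eu Au; rewrite !fnd_set; case: eqP => [E|_]; first by rewrite E in Au.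
    move=> /sub; rewrite Eu => -[<-]; case: eqP => // _ E nu.
    have : u \in [:: s x; s y] by apply: full; rewrite E.
    by rewrite !inE => /orP[]/eqP E'; rewrite E' hid_s // in nu; lia.
  have Hx' : 0 < x <= K by lia.
  have Hy' : 0 < y <= K by lia.
  by rewrite (aux _ _ _ Hx' Ex Ax R1 R2 na) (aux _ _ _ Hy' Ey Ay R3 R4 nb).
move=> E; subst b; exists (fun k => k \in [:: s x; s y]); split; last exact: sat_true.
set h1 := filterf _ _.
have lk k : h1.[? k] = if k \in [:: s x; s y] then h.[? k] else None.
  by rewrite fnd_filterf.
have nal : (a \in [:: s x; s y]) = false.
  apply/negP; rewrite !inE => /orP[]/eqP; apply: nas; lia.
have Lx : h1.[? s x] = Some a by rewrite lk mem_head.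
have Ly : h1.[? s y] = Some a by rewrite lk !inE eqxx orbT.
have neg i : 0 < i <= K -> (s i == a) = false.
  by move=> Hi; apply/negP => /eqP E; apply: (nas i).
have ns1 i : 1 < i <= K -> s i <> s 1 by move=> Hi /s_inj; lia.
split.
  apply/sat_size; apply: (@size_domfE _ [:: s x; s y]).
    by rewrite /= inE andbT; apply/eqP.
  move=> k; split; last by rewrite lk; case: (k \in _).
  by rewrite !inE => /orP[]/eqP->; rewrite ?Lx ?Ly.
split; first by split; apply/sat_alloc; rewrite ?Lx ?Ly.
apply/sat_sept_one; exists a, (s 1); split; [by rewrite lk nal|exact: sat_true|].
have Hx' : 0 < x <= K by lia.
have Hy' : 0 < y <= K by lia.
have na1 : a <> s 1 by apply: nas.
have xa : s x <> a by apply/eqP; rewrite neg.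
have ya : s y <> a by apply/eqP; rewrite neg.
by split; apply/sat_reach2; exists a; rewrite !fnd_set eqxx neg //; split=> //; auto.
Qed.

(* The negated septraction says that the content a of s x is allocated in the
   three-cell heap, so that the only cell that can be added on the paths to s 1
   is the successor of a, which must then be the content of s y. *)
Definition FApt x y :=
  FStar (FAnd (FSize 3) (FAnd (FAnd (FAlloc x) (FAlloc y))
    (FAnd (FNeg (FSept (FAnd FOne FTrue) (FReach 2 x 1)))
      (FSept (FAnd FOne FTrue) (FAnd (FReach 3 x 1) (FReach 2 y 1)))))) FTrue.

Lemma sat_apt h x y a b : x <> y -> var h x a -> var h y b ->
  sat s h (FApt x y) <-> vis h a b.
Proof.
move=> nxy [Hx Ex na] [Hy Ey nb].
have neqs : s x <> s y by move/s_inj; lia.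
have nas i : 0 < i <= K -> a <> s i by move=> Hi E; rewrite E hid_s in na.
have nbs i : 0 < i <= K -> b <> s i by move=> Hi E; rewrite E hid_s in nb.
have Hx' : 0 < x <= K by lia.
have Hy' : 0 < y <= K by lia.
have ns1 i : 1 < i <= K -> s i <> s 1 by move=> Hi /s_inj; lia.
have na1 : a <> s 1 by apply: nas.
have nb1 : b <> s 1 by apply: nbs.
have xa : s x <> a by move=> E; case: (nas x).
have ya : s y <> a by move=> E; case: (nas y).
have xb : s x <> b by move=> E; case: (nbs x).
have yb : s y <> b by move=> E; case: (nbs y).
have uxya : uniq [:: s x; s y; a].
  by rewrite /= !inE !negb_or !andbT -andbA; apply/and3P; split; apply/eqP.
rewrite /FApt /vis na nb sat_star; split.
  case=> P []/sat_and[/sat_size sz /sat_and[/sat_and[/sat_alloc Ax /sat_alloc Ay]]] + _.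
  set h1 := filterf h P in sz Ax Ay *.
  have sub k c : h1.[? k] = Some c -> h.[? k] = Some c.
    by rewrite fnd_filterf; case: (P k).
  have Lx : h1.[? s x] = Some a.
    by case E: h1.[? s x] Ax => [c|//] _; rewrite -Ex (sub _ _ E).
  have Ly : h1.[? s y] = Some b.
    by case E: h1.[? s y] Ay => [c|//] _; rewrite -Ey (sub _ _ E).
  move=> /sat_and[/sat_neg N /sat_sept_one[m [n [nm _ /sat_and[/sat_reach3[a' [c [R1 R2 R3 u]]]
    /sat_reach2[b' [R4 R5 _ _ _]]]]]]].
  (* If [a] were free, the cell from [a] to [s 1] could be added, giving the path that [N]
     excludes. *)
  have [c' La] : exists c', h1.[? a] = Some c'.
    case La : h1.[? a] => [c'|]; first by exists c'.
    case: N; apply/sat_sept_one; exists a, (s 1); split=> //; first exact: sat_true.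
    apply/sat_reach2; exists a; rewrite !fnd_set eqxx.
    have /eqP/negbTE -> : s x <> a by auto.
    by split=> //; auto.
  have full : forall k, h1.[? k] <> None -> k \in [:: s x; s y; a].
    apply: domf_full; rewrite ?sz //.
    by move=> k; rewrite !inE => /or3P[]/eqP->; rewrite ?La.
  have old k v : h1.[? k] = Some v -> h1.[m <- n].[? k] = Some v.
    by move=> E; rewrite fnd_set; case: eqP => // Em; rewrite Em nm in E.
  move: (old _ _ Lx) (old _ _ Ly) (old _ _ La).
  rewrite R1 R4 => -[?] [?]; subst a' b'; rewrite R2 => -[?]; subst c'.
  move: u; rewrite /= !inE !negb_or andbT => /and3P[/and3P[_ xc _] /andP[ac a1] c1].
  (* Both [b] and [c] point to [s 1] after the addition, and none of the three old cells can do so;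
     hence both are the new cell. *)
  have bm : b = m.
    apply/eqP; apply: contraTT isT => /eqP bm.
    have : b \in [:: s x; s y; a].
      by apply: full; move: R5; rewrite fnd_set; case: eqP => // _ ->.
    rewrite !inE => /or3P[]/eqP E; [by case: (nbs x)|by case: (nbs y)|].
    by move: R5; rewrite E R2 => -[E1]; rewrite E1 eqxx in c1.
  have cm : c = m.
    apply/eqP; apply: contraTT isT => /eqP cm.
    have : c \in [:: s x; s y; a].
      by apply: full; move: R3; rewrite fnd_set; case: eqP => // _ ->.
    rewrite !inE => /or3P[]/eqP E; [by rewrite E eqxx in xc| |by rewrite E eqxx in ac].
    by move: R3; rewrite E R4 => -[E1]; case: (nbs 1).
  by rewrite bm -{1}cm ac (sub _ _ La) cm eqxx.
move=> /and4P[_ _ /eqP nab /eqP Ea].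
exists (fun k => k \in [:: s x; s y; a]); split; last exact: sat_true.
set h1 := filterf _ _.
have lk k : h1.[? k] = if k \in [:: s x; s y; a] then h.[? k] else None.
  by rewrite fnd_filterf.
have Lx : h1.[? s x] = Some a by rewrite lk mem_head.
have Ly : h1.[? s y] = Some b by rewrite lk !inE eqxx orbT.
have La : h1.[? a] = Some b by rewrite lk !inE eqxx !orbT.
have Lb : h1.[? b] = None.
  rewrite lk; case: ifP => //; rewrite !inE => /or3P[]/eqP E.
  - by case: (nbs x).
  - by case: (nbs y).
  - by case: nab.
have old m n k v : h1.[? m] = None -> h1.[? k] = Some v -> h1.[m <- n].[? k] = Some v.
  by move=> nm E; rewrite fnd_set; case: eqP => // Em; rewrite Em nm in E.
split.
  apply/sat_size; apply: (@size_domfE _ [:: s x; s y; a]) => // k.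
  split; last by rewrite lk; case: (k \in _).
  by rewrite !inE => /or3P[]/eqP->; rewrite ?Lx ?Ly ?La.
apply/sat_and; split; first by split; apply/sat_alloc; rewrite ?Lx ?Ly.
apply/sat_and; split.
  (* The path from [s x] over [a] to [b] survives any addition, and [b] is not [s 1]. *)
  apply/sat_neg; move/sat_sept_one=> [m [n [nm _ /sat_reach2[a' [R1 R2 _ _ _]]]]].
  move: R1 R2; rewrite (old m n _ _ nm Lx) => -[<-].
  by rewrite (old m n _ _ nm La) => -[E]; case: (nbs 1).
apply/sat_sept_one; exists b, (s 1); split; [by []|exact: sat_true|].
split.
  apply/sat_reach3; exists a, b; rewrite !(old b (s 1) _ _ Lb Lx, old b (s 1) _ _ Lb La).
  rewrite fnd_set eqxx; split=> //.
  by rewrite /= !inE !negb_or !andbT; repeat (apply/andP; split); apply/eqP;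
    auto.
apply/sat_reach2; exists b; rewrite (old b (s 1) _ _ Lb Ly) fnd_set eqxx.
by split=> //; auto.
Qed.

Lemma sat_edge (h : heap) E l x y a b : st h E l -> var h x a -> var h y b -> x <> y ->
  sat s h (FApt x y) <-> E a b.
Proof. by move=> [_ _ _ <-] Vx Vy n; apply: sat_apt. Qed.

Lemma and_iff_compat A B C D : (A <-> B) -> (C <-> D) -> (A /\ C <-> B /\ D).
Proof. tauto. Qed.
Lemma and_iff_compat_dep A B C D :
  (A <-> B) -> (B -> (C <-> D)) -> (A /\ C <-> B /\ D).
Proof. tauto. Qed.
Lemma or_iff_compat A B C D : (A <-> B) -> (C <-> D) -> (A \/ C <-> B \/ D).
Proof. tauto. Qed.
Lemma imp_iff_compat A B C D : (A <-> B) -> (C <-> D) -> ((A -> C) <-> (B -> D)).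
Proof. tauto. Qed.

(** Translates a formula, connective by connective, into a statement about [E]; a conditional is
    left to the caller. *)
Ltac fosem :=
  lazymatch goal with
  | |- sat _ _ (FAnd _ _) <-> _ =>
      eapply iff_trans; [apply sat_and | apply and_iff_compat; fosem]
  | |- sat _ _ (FImp _ _) <-> _ =>
      eapply iff_trans; [apply sat_imp | apply imp_iff_compat; fosem]
  | |- sat _ _ (FOr _ _) <-> _ =>
      eapply iff_trans; [apply sat_or | apply or_iff_compat; fosem]
  | |- sat _ _ (FNeg _) <-> _ =>
      eapply iff_trans; [apply sat_neg | apply not_iff_compat; fosem]
  | |- sat _ _ (FAll _ _) <-> _ =>
      eapply sat_all; [eassumption | lia | intros; fosem]
  | |- sat _ _ (FEx _ _) <-> _ =>
      eapply sat_ex; [eassumption | lia | intros; fosem]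
  | |- sat _ _ (FApt _ _) <-> _ =>
      eapply sat_edge; [eassumption | solve [eauto 20] | solve [eauto 20] | lia]
  | |- sat _ _ (FAeq _ _) <-> _ =>
      eapply sat_aeq; [lia | solve [eauto 20] | solve [eauto 20]]
  | |- sat _ _ (if ?b then _ else _) <-> _ => idtac
  end.

Lemma visP h x y : vis h x y <-> [/\ ~~ hid x, ~~ hid y, x <> y & h.[? x] = Some y].
Proof.
rewrite /vis; split=> [/and4P[? ? /eqP ? /eqP ?] //|[-> -> /eqP -> ->]].
by rewrite eqxx.
Qed.

Lemma st_hid h E l x y : st h E l -> E x y -> [/\ ~~ hid x, ~~ hid y & x <> y].
Proof. by move=> [_ _ _ <-] /visP[]. Qed.

(** * Comparing in-degrees *)

Definition npred (E : rel nat) a l := uniq l /\ forall u, (u \in l) = E u a.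

Definition predl (h : heap) a := [seq u <- domf h | vis h u a].

Lemma npred_predl h E l a : st h E l -> npred E a (predl h a).
Proof.
move=> [_ _ _ V]; split=> [|u]; first by rewrite filter_uniq ?fset_uniq.
rewrite mem_filter V; case: (boolP (E u a)) => //=; rewrite -V => /visP[_ _ _ H].
by rewrite -[_ \in _]/(u \in h) -fndSome H.
Qed.

Lemma npred_size E a l1 l2 : npred E a l1 -> npred E a l2 -> size l1 = size l2.
Proof.
move=> [u1 H1] [u2 H2]; apply/perm_size/uniq_perm => // x.
by rewrite H1 H2.
Qed.

Definition FNoPred l x := FAll l (FNeg (FApt l x)).

Lemma sat_nopred h E l x a : st h E l -> l <= K -> var h x a ->
  sat s h (FNoPred l x) <-> forall u, ~ E u a.
Proof.
move=> S lK V; have lt := var_lt S V.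
apply: (@iff_trans _ (forall u, ~~ hid u -> ~ E u a)); first by rewrite /FNoPred; fosem.
by split=> H u; [move=> Eu; case: (H u) => //; case: (st_hid S Eu)|move=> _; apply: H].
Qed.

(* At most k (0 or 1) predecessors of x have a predecessor themselves. *)
Definition FFew (k : bool) l x :=
  FAll l (FAll l.+1 (FAll l.+2 (FAll l.+3
    (FImp (FAnd (FAnd (FApt l.+1 l) (FApt l x)) (FAnd (FApt l.+3 l.+2) (FApt l.+2 x)))
      (if k then FAeq l l.+2 else FNeg FTrue))))).

Lemma sat_few k h E l x a : st h E l -> l + 3 <= K -> var h x a ->
  sat s h (FFew k l x) <->
  forall u w u' w', E w u -> E u a -> E w' u' -> E u' a -> k /\ u = u'.
Proof.
move=> S lK V; have lt := var_lt S V.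
apply: (@iff_trans _ (forall u, ~~ hid u -> forall w, ~~ hid w -> forall u', ~~ hid u' ->
  forall w', ~~ hid w' -> (E w u /\ E u a) /\ (E w' u' /\ E u' a) -> k /\ u = u')).
  rewrite /FFew; fosem; case: k; cbv iota.
    by eapply iff_trans; [fosem | split=> [->|[]//]].
  by rewrite sat_neg; split=> [[]|[]//]; apply: sat_true.
split=> H.
  move=> u w u' w' E1 E2 E3 E4.
  have [? ? _] := st_hid S E1; have [? ? _] := st_hid S E3.
  exact: (H u _ w _ u' _ w').
by move=> u _ w _ u' _ w' _ [[? ?] [? ?]]; apply: (H u w u' w').
Qed.

Definition FInj l := FAll l (FAll l.+1 (FAll l.+2
  (FImp (FAnd (FApt l l.+2) (FApt l.+1 l.+2)) (FAeq l l.+1)))).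

Lemma sat_inj h E l : st h E l -> l + 2 <= K ->
  sat s h (FInj l) <-> forall u u' v, E u v -> E u' v -> u = u'.
Proof.
move=> S lK.
apply: (@iff_trans _ (forall u, ~~ hid u -> forall u', ~~ hid u' -> forall v, ~~ hid v ->
  E u v /\ E u' v -> u = u')); first by rewrite /FInj; fosem.
split=> H.
  move=> u u' v E1 E2; have [? ? _] := st_hid S E1; have [? ? _] := st_hid S E2.
  exact: (H u _ u' _ v).
by move=> u _ u' _ v _ []; apply: H.
Qed.

(** In the comparison the retained edges end in predecessors of [x]; the formula forces these to
    have a path of length two to [y], the shorter cases being ruled out there. *)
Definition FNear l y := FAll l (FAll l.+1 (FImp (FApt l l.+1)
  (FOr (FAeq l.+1 y) (FOr (FApt l.+1 y) (FEx l.+2 (FAnd (FApt l.+1 l.+2) (FApt l.+2 y))))))).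

Lemma sat_near h E l y b : st h E l -> l + 2 <= K -> var h y b ->
  sat s h (FNear l y) <-> forall u v, E u v ->
    v = b \/ E v b \/ exists2 t, E v t & E t b.
Proof.
move=> S lK V; have lt := var_lt S V.
apply: (@iff_trans _ (forall u, ~~ hid u -> forall v, ~~ hid v -> E u v ->
   v = b \/ E v b \/ exists2 t, ~~ hid t & E v t /\ E t b)); first by rewrite /FNear; fosem.
split=> H.
  move=> u v E1; have [nu nv _] := st_hid S E1.
  by have [|[|[t _ [? ?]]]] := H u nu v nv E1; auto; right; right; exists t.
move=> u _ v _ /H [|[|[t E1 E2]]]; auto; right; right; exists t => //.
by have [] := st_hid S E1.
Qed.

Definition FFree l := FBigAnd [seq FNeg (FAlloc i) | i <- 1 :: iota l (K.+1 - l)].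

Lemma sat_free h l : sat s h (FFree l) <->
  h.[? s 1] = None /\ forall i, l <= i <= K -> h.[? s i] = None.
Proof.
rewrite /FFree sat_bigand; split=> [H|[H1 H2] i].
  have F i : i \in 1 :: iota l (K.+1 - l) -> h.[? s i] = None.
    by move=> /H /sat_neg N; apply: NNPP => E; apply: N; apply/sat_alloc.
  by split=> [|i Hi]; apply: F; rewrite // inE mem_iota; apply/orP; right; lia.
rewrite inE mem_iota => Hi; apply/sat_neg => /sat_alloc; apply.
by case/orP: Hi => [/eqP -> //|Hi]; apply: H2; lia.
Qed.

(* Compares the predecessors of x (or of its copy l) with those of the copy
   l+1 of y: the right conjunct of the separating conjunction keeps the edges
   into the predecessors of x, but not the edges from these into x itself, so
   the added heap can map the predecessors of x injectively to those of y. *)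
Definition FCmpCore (k : bool) l x :=
  FStar (FAnd (FAlloc x) (FFew k l.+3 x))
    (FAnd (FAnd (FAlloc l) (FAlloc l.+1))
      (FAnd (FNoPred l.+3 l)
        (FSept (FAnd (FAnd (FAlloc l.+2) (FNotHid l.+2))
                     (FAnd (FFree l.+3) (FAnd (FNoPred l.+3 l.+2) (FInj l.+3))))
               (FAnd (FAeq l.+1 l.+2) (FNear l.+3 l.+1))))).

Lemma fnd_filter_some (h : heap) P x y : (filterf h P).[? x] = Some y <-> P x /\ h.[? x] = Some y.
Proof. by rewrite fnd_filterf; case: (P x); split=> // -[]. Qed.

Lemma vis_filter h P x y : vis (filterf h P) x y = P x && vis h x y.
Proof.
apply/idP/idP => [/visP[? ? ? /fnd_filter_some[-> ?]]|/andP[? /visP[? ? ? ?]]]; apply/visP; split=> //.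
by apply/fnd_filter_some.
Qed.

Lemma vis_add h1 h2 u v : hdisj h1 h2 ->
  vis (h1 + h2)%fset u v <-> vis h1 u v \/ vis h2 u v.
Proof.
move=> d; have /hdisjP/(_ u) dd := d; have L := fnd_hadd u d.
split=> [/visP[? ? ?]|[]/visP[? ? ? Eu]].
- rewrite L; case Eu: h1.[? u] => [y|] E'; [left|right]; apply/visP; split=> //.
  by rewrite Eu.
- by apply/visP; rewrite L Eu.
- by apply/visP; rewrite L; case: dd => [->|]; rewrite Eu.
Qed.

Lemma st_filter h E l l' P : st h E l -> l <= l' -> st (filterf h P) (vis (filterf h P)) l'.
Proof.
move=> [l1 h1 F _] le; split=> [||i Hi|//]; first lia.
- by rewrite fnd_filterf h1; case: ifP.
- by rewrite fnd_filterf F ?if_same //; lia.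
Qed.

Lemma var_filter (h : heap) P x a : var h x a -> (filterf h P).[? s x] <> None ->
  var (filterf h P) x a.
Proof.
move=> [H Ex n]; rewrite fnd_filterf => N; split=> //.
by rewrite fnd_filterf; case: (P _) N.
Qed.

Lemma size_drop_few (k : bool) (l : seq nat) :
  (forall u v, u \in l -> v \in l -> k /\ u = v) -> uniq l -> size l <= k.
Proof.
case: l => [|u [|v l]] // H /=.
  by have [] := H u u (mem_head _ _) (mem_head _ _) => -> _.
rewrite inE negb_or => /andP[/andP[/eqP n _] _]; case: n.
by have [] := H u v (mem_head _ _); rewrite // !inE eqxx orbT.
Qed.

Section Core.
Variables (h : heap) (E : rel nat) (l x a b : nat) (k : bool).
Hypotheses (S : st h E l.+2) (lK : l + 6 <= K) (xl : x < l).
Hypotheses (Vx : var h x a) (V1 : var h l a) (V2 : var h l.+1 b).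
Hypotheses (nab : a <> b) (nba : ~ E b a).
Hypothesis good : forall u, E u a -> exists w, E w u.

Let vE u v : vis h u v = E u v. Proof. by have [_ _ _ ->] := S. Qed.

(** A predecessor of [a] either has an incoming edge in the left heap, which [FFew] allows for at
    most [k] of them, or keeps one on the right. In the latter case [FNear] leads it by an added
    edge to a predecessor of [b], and added edges are injective. *)
Lemma core_sound : sat s h (FCmpCore k l x) ->
  exists la lb, [/\ npred E a la, npred E b lb & size la <= size lb + k].
Proof.
case/sat_star=> P []/sat_and[/sat_alloc Ax Few]
  /sat_and[/sat_and[/sat_alloc A1 /sat_alloc A2] /sat_and[NP]].
set G := filterf h P in Ax Few; set H2 := filterf h _ in A1 A2 NP *.
have SG : st G (vis G) l.+3 by apply: st_filter S _; lia.
have SH : st H2 (vis H2) l.+3 by apply: st_filter S _; lia.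
have VGx : var G x a by apply: var_filter.
have VH1 : var H2 l a by apply: var_filter.
have VH2 : var H2 l.+1 b by apply: var_filter.
have lK3 : l.+3 <= K by lia.
have lK5 : l.+3 + 2 <= K by lia.
have lK6 : l.+3 + 3 <= K by lia.
have {}Few := (sat_few k SG lK6 VGx).1 Few.
have {}NP := (sat_nopred SH lK3 VH1).1 NP.
case/sat_sept=> h3 [d /sat_and[/sat_and[/sat_alloc A3 NH]
  /sat_and[/sat_free[F1 F3] /sat_and[NP3 Inj]]] /sat_and[Eq Near]].
case E3: h3.[? s l.+2] A3 => [b3|//] _.
have nb3 := (sat_nothid E3).1 NH.
have S3 : st h3 (vis h3) l.+3 by split.
have V3 : var h3 l.+2 b3 by split=> //; lia.
have {}NP3 := (sat_nopred S3 lK3 V3).1 NP3.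
have {}Inj := (sat_inj S3 lK5).1 Inj.
set C := (H2 + h3)%fset in Eq Near.
have LC u : C.[? u] = if H2.[? u] is Some y then Some y else h3.[? u].
  exact: fnd_hadd.
have visC u v : vis C u v <-> vis H2 u v \/ vis h3 u v by apply: vis_add.
have SC : st C (vis C) l.+3.
  have [? H21 H2F _] := SH.
  by split=> // [|i Hi]; rewrite LC ?H21 ?F1 // H2F // F3.
have VC2 : var C l.+1 b.
  by have [? Eb ?] := VH2; split=> //; rewrite LC Eb.
have VC3 : var C l.+2 b3.
  have [? Eb ?] := V3; split=> //; rewrite LC.
  have /hdisjP/(_ (s l.+2)) := d; rewrite Eb; case=> [->|] //.
have Eb : b = b3 by apply: (sat_aeq _ VC2 VC3).1 Eq; lia.
have {}Near := (sat_near SC lK5 VC2).1 Near.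
rewrite -Eb in NP3.
pose exc u := has (fun w => vis G w u) (domf h).
have excP u : exc u <-> exists w, vis G w u.
  split=> [/hasP[w _ Hw]|[w Hw]]; first by exists w.
  apply/hasP; exists w => //; move: Hw; rewrite vis_filter => /andP[_ /visP[_ _ _ Hw]].
  by rewrite -[_ \in _]/(w \in h) -fndSome Hw.
(* The cell of [u] lies on the left, so the only edge from [u] in the union is an added one. Added
   edges do not enter [b], and [u] is not [b], so of the cases of [FNear] only the path of length
   two remains. *)
have key u : E u a -> ~~ exc u -> exists2 t, vis h3 u t & E t b.
  move=> Eu nx; have [w Ew] := good Eu.
  have Gw : ~~ P w.
    by apply: contra nx => Pw; apply/excP; exists w; rewrite vis_filter Pw vE.
  have Gu : P u.
    apply: contraT => nP; case: (NP u); rewrite vis_filter /= nP vE; exact: Eu.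
  have Hu v : vis C u v -> vis h3 u v.
    by case/visC => //; rewrite vis_filter /= Gu.
  have Hb t : vis C t b -> E t b.
    by case/visC => [|/NP3 //]; rewrite vis_filter vE => /andP[].
  have : vis C w u by apply/visC; left; rewrite vis_filter /= Gw vE.
  case/Near=> [Eub|[/Hu/NP3//|[t /Hu E1 /Hb E2]]].
    by case: nba; rewrite -Eub.
  by exists t.
exists (predl h a), (predl h b); have nA := npred_predl a S; have nB := npred_predl b S.
split=> //; rewrite -(count_predC exc) -!size_filter addnC leq_add //.
  pose f u := odflt 0 h3.[? u].
  have fP u t : vis h3 u t -> f u = t by case/visP => _ _ _; rewrite /f => ->.
  rewrite -(size_map f); apply: uniq_leq_size.
    rewrite map_inj_in_uniq; first by rewrite !filter_uniq ?fset_uniq.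
    move=> u v; rewrite mem_filter nA.2 => /andP[nu Eu].
    rewrite mem_filter nA.2 => /andP[nv Ev].
    have [t Ht _] := key u Eu nu; have [t' Ht' _] := key v Ev nv.
    rewrite (fP _ _ Ht) (fP _ _ Ht') => Et; apply: (Inj u v t) => //.
    by rewrite Et.
  move=> y /mapP[u]; rewrite mem_filter nA.2 => /andP[nu Eu] ->.
  by have [t Ht Et] := key u Eu nu; rewrite (fP _ _ Ht) nB.2.
apply: size_drop_few; last by rewrite !filter_uniq ?fset_uniq.
move=> u v; rewrite mem_filter nA.2 => /andP[/excP[w Hw] Eu].
rewrite mem_filter nA.2 => /andP[/excP[w' Hw'] Ev].
have inG t : E t a -> vis G t a.
  move=> Et; have := NP t; rewrite !vis_filter !vE Et !andbT /=.
  by case: (P t) => // /(_ isT).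
by apply: (Few u w v w') => //; apply: inG.
Qed.

(** The first [k] predecessors of [a] are set aside; the others form [U] and are sent, in order, to
    the elements of [lb]. The right heap consists of the two copies, the edges into [b] and the
    edges into [U]. *)
Lemma core_complete la lb : npred E a la -> npred E b lb -> size la <= size lb + k ->
  sat s h (FCmpCore k l x).
Proof.
move=> [ua Ha] [ub Hb] sz.
have lK3 : l.+3 <= K by lia.
have lK5 : l.+3 + 2 <= K by lia.
have lK6 : l.+3 + 3 <= K by lia.
pose U := drop k la; pose f u := nth 0 lb (index u U).
have UE u : u \in U -> E u a by move=> /mem_drop; rewrite Ha.
have uU : uniq U by apply: drop_uniq.
have sU : size U <= size lb by rewrite size_drop; lia.
have fE u : u \in U -> E (f u) b.
  by move=> uU'; rewrite -Hb mem_nth // (leq_trans _ sU) // index_mem.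
have fI u v : u \in U -> v \in U -> f u = f v -> u = v.
  move=> Hu Hv /eqP; rewrite nth_uniq ?(leq_trans _ sU) ?index_mem //.
  by move=> /eqP/(f_equal (nth 0 U)); rewrite !nth_index.
have hidE u v : E u v -> [/\ ~~ hid u, ~~ hid v & u <> v] by apply: st_hid S.
have funE u v w : E u v -> E u w -> v = w.
  by rewrite -!vE => /visP[_ _ _ E1] /visP[_ _ _]; rewrite E1 => -[].
pose Q u := [|| u == s l, u == s l.+1, E u b | has (E u) U].
have Qhid u : ~~ hid u -> Q u = E u b || has (E u) U.
  by move=> nu; rewrite /Q !(hid_neq nu _).1 //; lia.
apply/sat_star; exists (predC Q); set G := filterf h _; set H2 := filterf h _.
have SG : st G (vis G) l.+3 by apply: st_filter S _; lia.
have SH : st H2 (vis H2) l.+3 by apply: st_filter S _; lia.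
have visG u v : vis G u v = ~~ Q u && E u v by rewrite vis_filter vE.
have visH u v : vis H2 u v = Q u && E u v by rewrite vis_filter vE /= negbK.
have [Kx Ex na] := Vx; have [K1 E1 _] := V1; have [K2 E2 nb] := V2.
have Gx : G.[? s x] = Some a.
  apply/fnd_filter_some; split=> //=; rewrite /Q !negb_or; apply/and4P; split.
  - by apply/eqP => /s_inj; lia.
  - by apply/eqP => /s_inj; lia.
  - by apply/negP => /hidE[]; rewrite hid_s //; lia.
  - by apply/hasP => -[w _ /hidE[]]; rewrite hid_s //; lia.
have HH1 : H2.[? s l] = Some a by apply/fnd_filter_some; rewrite /= /Q eqxx.
have HH2 : H2.[? s l.+1] = Some b by apply/fnd_filter_some; rewrite /= /Q eqxx orbT.
split; [apply/sat_and; split|].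
- by apply/sat_alloc; rewrite Gx.
- apply/(@sat_few k G (vis G) l.+3 x a) => // u w u' w'.
  have aux t v : vis G t v -> vis G v a -> v \in take k la.
    rewrite !visG => /andP[nQ Etv] /andP[_]; rewrite -Ha -{1}(cat_take_drop k la).
    rewrite mem_cat => /orP[//|vU]; case/negP: nQ.
    have [nt _ _] := hidE _ _ Etv; rewrite Qhid //.
    by apply/orP; right; apply/hasP; exists v.
  move=> A1 A2 /aux A3 /A3; move: (aux _ _ A1 A2).
  case: (k); last by rewrite take0.
  by case: (la) => // t ? /=; rewrite take0 !inE => /eqP -> /eqP ->.
apply/sat_and; split; first by split; apply/sat_alloc; rewrite ?HH1 ?HH2.
apply/sat_and; split.
  apply/(@sat_nopred H2 (vis H2) l.+3 l a) => // u; rewrite visH => /andP[Qu Eu].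
  have [nu _ _] := hidE _ _ Eu; move: Qu; rewrite Qhid // => /orP[/(funE _ _ _ Eu)//|].
  case/hasP=> v /UE Ev /(funE _ _ _ Eu) E'; rewrite -E' in Ev.
  by have [] := hidE _ _ Ev.
(* The only successor of such a [u] is [a], which is neither [b] nor, as there are no loops, a
   member of [U]; so the cell of [u] is not on the right. *)
have dU u : u \in U -> H2.[? u] = None.
  move=> uU'; have [nu _ _] := hidE _ _ (UE _ uU').
  rewrite fnd_filterf /= negbK Qhid // orbC; case: hasP => [[v vU Ev]|_] /=.
    have := UE _ vU; rewrite -(funE _ _ _ (UE _ uU') Ev) => /hidE[] //.
  by case: ifP => // Eub; case: nab; apply: funE (UE _ uU') Eub.
have sU' i u : 0 < i <= K -> u \in U -> s i <> u.
  by move=> Hi /UE/hidE[nu _ _] Ei; rewrite -Ei hid_s in nu.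
pose h3 := (mkheap f U).[s l.+2 <- b].
have L3 u : h3.[? u] = if u == s l.+2 then Some b else if u \in U then Some (f u) else None.
  by rewrite fnd_set fnd_mkheap.
have vis3 u v : vis h3 u v = (u \in U) && (v == f u).
  apply/idP/idP => [/visP[nu nv _]|/andP[uU' /eqP->]].
    by rewrite L3 (hid_neq nu _).1; [case: ifP => // _ [->] /= | lia].
  have [nu _ _] := hidE _ _ (UE _ uU'); have [nv _ _] := hidE _ _ (fE _ uU').
  apply/visP; split=> //; last by rewrite L3 (hid_neq nu _).1 ?uU' //; lia.
  by move=> Eu; have := fE _ uU'; rewrite -Eu => Eub; apply/nab/(funE u) => //; apply: UE.
have F3 i : 0 < i <= K -> i <> l.+2 -> h3.[? s i] = None.
  move=> Hi ni; rewrite L3; case: eqP => [/s_inj|_]; first lia.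
  by case: ifP => // /(sU' _ _ Hi).
have S3 : st h3 (vis h3) l.+3.
  by split=> // [|i Hi]; apply: F3; lia.
have V3 : var h3 l.+2 b by split; rewrite ?L3 ?eqxx //; lia.
have d : hdisj H2 h3.
  apply/hdisjP => u; rewrite L3; case: eqP => [->|_].
    by left; rewrite fnd_filterf; have [_ _ F _] := S; rewrite F ?if_same //; lia.
  by case: ifP => [/dU|_]; [left|right].
apply/sat_sept; exists h3; split=> //.
  apply/sat_and; split.
    split; first by apply/sat_alloc; rewrite L3 eqxx.
    by apply/(@sat_nothid _ _ b); rewrite ?L3 ?eqxx.
  apply/sat_and; split.
    by apply/sat_free; split=> [|i Hi]; apply: F3; lia.
  apply/sat_and; split.
    apply/(@sat_nopred h3 (vis h3) l.+3 l.+2 b) => // u; rewrite vis3 => /andP[/fE Ef /eqP Eb].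
    by rewrite -Eb in Ef; have [] := hidE _ _ Ef.
  apply/(@sat_inj h3 (vis h3) l.+3) => // u u' v.
  by rewrite !vis3 => /andP[Hu /eqP ->] /andP[Hu' /eqP]; apply: fI.
set C := (H2 + h3)%fset.
have LC u : C.[? u] = if H2.[? u] is Some y then Some y else h3.[? u].
  exact: fnd_hadd.
have visC u v : vis C u v <-> vis H2 u v \/ vis h3 u v by apply: vis_add.
have SC : st C (vis C) l.+3.
  have [? H21 H2F _] := SH.
  by split=> // [|i Hi]; rewrite LC ?H21 ?H2F // F3 //; lia.
have VC2 : var C l.+1 b by split=> //; rewrite LC HH2.
have VC3 : var C l.+2 b.
  split=> //; first lia.
  by have /hdisjP/(_ (s l.+2)) := d; rewrite LC L3 eqxx; case=> [->|].
apply/sat_and; split; first by apply/(sat_aeq _ VC2 VC3) => //; lia.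
apply/(sat_near SC lK5 VC2) => u v /visC[]; last first.
  rewrite vis3 => /andP[/fE Ef /eqP ->]; right; left; apply/visC; left.
  by have [nf _ _] := hidE _ _ Ef; rewrite visH Ef Qhid ?Ef.
rewrite visH => /andP[Qu Eu]; have [nu _ _] := hidE _ _ Eu.
move: Qu; rewrite Qhid // => /orP[/(funE _ _ _ Eu)|]; first by left.
case/hasP=> w wU /(funE _ _ _ Eu) ->; right; right; exists (f w); apply/visC.
  by right; rewrite vis3 wU eqxx.
left; have Ef := fE _ wU.
by have [nf _ _] := hidE _ _ Ef; rewrite visH Ef Qhid ?Ef.
Qed.

End Core.

(** Copies are made because the core splits the heap: the cell of [x] goes to the left, yet the
    right part must still name both nodes. *)
Definition FCmp k l x y :=
  FAnd (FAnd (FNeg (FAeq x y)) (FAnd (FNeg (FApt y x))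
         (FAll l (FImp (FApt l x) (FEx l.+1 (FApt l.+1 l))))))
       (FEx l (FEx l.+1 (FAnd (FAnd (FAeq l x) (FAeq l.+1 y)) (FCmpCore k l x)))).

(** The conditions under which the core test is proved exact. Each predecessor of [a] must have an
    incoming edge because [FNear] speaks only about the ends of edges. *)
Definition cmpok (E : rel nat) a b :=
  [/\ a <> b, ~ E b a & forall u, E u a -> exists w, E w u].

Lemma sat_cmp k h E l x y a b : st h E l -> l + 6 <= K -> x <> y ->
  var h x a -> var h y b ->
  sat s h (FCmp k l x y) <-> cmpok E a b /\
    exists la lb, [/\ npred E a la, npred E b lb & size la <= size lb + k].
Proof.
move=> S lK nxy Vx Vy; have Hx := var_lt S Vx; have Hy := var_lt S Vy.
rewrite /FCmp sat_and.
have -> : sat s h (FAnd (FNeg (FAeq x y)) (FAnd (FNeg (FApt y x))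
  (FAll l (FImp (FApt l x) (FEx l.+1 (FApt l.+1 l)))))) <-> cmpok E a b.
  apply: (@iff_trans _ (a <> b /\ (~ E b a /\ forall u, ~~ hid u -> E u a ->
    exists2 w, ~~ hid w & E w u))); first by fosem.
  split=> [[n1 [n2 H]]|[n1 n2 H]].
    split=> // u Eu; have [nu _ _] := st_hid S Eu; have [w _ Ew] := H u nu Eu.
    by exists w.
  split=> //; split=> // u nu /H[w Ew]; exists w => //.
  by have [] := st_hid S Ew.
set LE := exists _ _, _.
suff core : cmpok E a b -> sat s h (FEx l (FEx l.+1
    (FAnd (FAnd (FAeq l x) (FAeq l.+1 y)) (FCmpCore k l x)))) <-> LE.
  by split=> -[/[dup] /core [A B] ? ?]; auto.
move=> [n1 n2 good].
apply: (@iff_trans _ (exists2 c, ~~ hid c & exists2 d, ~~ hid d & (c = a /\ d = b) /\ LE)).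
  apply: (sat_ex S) => [|c h1 nc S1 V1 M1]; first lia.
  apply: (sat_ex S1) => [|d h2 nd S2 V2 M2]; first lia.
  rewrite sat_and [sat _ _ (FAnd _ _)]sat_and.
  have -> : sat s h2 (FAeq l x) <-> c = a by fosem.
  have -> : sat s h2 (FAeq l.+1 y) <-> d = b by fosem.
  have Vx2 : var h2 x a by eauto.
  have Vc2 : var h2 l c by eauto.
  split=> -[[Ec Ed] H]; split=> //; subst c d.
    by apply: (core_sound S2 _ _ Vx2 Vc2 V2 _ _ _ H) => //; lia.
  case: H => la [lb [Ha Hb sz]].
  by apply: (core_complete S2 _ _ Vx2 Vc2 V2 _ _ Ha Hb sz) => //; lia.
split=> [[c _ [d _ []]] //|H].
by exists a; [have [] := Vx|exists b; [have [] := Vy|]].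
Qed.

(** * Describing a closed set of facts by a formula *)

Fixpoint epath (E : rel nat) n a b :=
  if n is n'.+1 then exists2 c, E a c & epath E n' c b else a = b.

Fixpoint FPath n l x y :=
  if n is n'.+1 then FEx l (FAnd (FApt x l) (FPath n' l.+1 l y)) else FAeq x y.

Fixpoint FChain n l x :=
  if n is n'.+1 then FEx l (FAnd (FApt x l) (FChain n' l.+1 l)) else FTrue.

Lemma sat_path n h E l x y a b : st h E l -> l + n <= K.+1 -> x <> y ->
  var h x a -> var h y b -> sat s h (FPath n l x y) <-> epath E n a b.
Proof.
elim: n h l x a => [|n IH] h l x a S lK nxy Vx Vy.
  by apply: sat_aeq.
have Hx := var_lt S Vx; have Hy := var_lt S Vy.
apply: (@iff_trans _ (exists2 c, ~~ hid c & E a c /\ epath E n c b)).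
  apply: (sat_ex S) => [|c h1 nc S1 V1 M1]; first lia.
  apply: (iff_trans (sat_and _ _ _ _)); apply: and_iff_compat; first by fosem.
  by apply: IH => //; [lia|lia|auto].
split=> [[c _ []]|[c E1 E2]]; exists c => //.
by have [] := st_hid S E1.
Qed.

Lemma sat_chain n h E l x a : st h E l -> l + n <= K.+1 -> var h x a ->
  sat s h (FChain n l x) <-> exists b, epath E n a b.
Proof.
elim: n h l x a => [|n IH] h l x a S lK Vx.
  by split=> _; [exists a|apply: sat_true].
have Hx := var_lt S Vx.
apply: (@iff_trans _ (exists2 c, ~~ hid c & E a c /\ exists b, epath E n c b)).
  apply: (sat_ex S) => [|c h1 nc S1 V1 M1]; first lia.
  apply: (iff_trans (sat_and _ _ _ _)); apply: and_iff_compat; first by fosem.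
  by apply: IH => //; lia.
split=> [[c _ [E1 [b Eb]]]|[b [c E1 E2]]]; first by exists b, c.
by exists c; [have [] := st_hid S E1|split=> //; exists b].
Qed.

(** [FCmp] fails on coinciding nodes, hence the first disjunct. *)
Definition FEqN l x y := FOr (FAeq x y) (FAnd (FCmp false l x y) (FCmp false l y x)).
(** The first comparison also ensures [cmpok], without which the failure of the second would say
    nothing about degrees. *)
Definition FSuccN l x y := FAnd (FCmp true l y x) (FNeg (FCmp false l y x)).
Definition FZeroN l x := FEx l (FAnd (FApt l x) (FAll l.+1 (FImp (FApt l.+1 x) (FAeq l l.+1)))).
Definition FPosN l x :=
  FEx l (FEx l.+1 (FAnd (FAnd (FApt l x) (FApt l.+1 x)) (FNeg (FAeq l l.+1)))).

Definition degree (E : rel nat) (d : nat -> nat) :=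
  forall a, exists2 l, npred E a l & size l = d a.

Lemma degree_le E d a b k : degree E d ->
  (exists la lb, [/\ npred E a la, npred E b lb & size la <= size lb + k]) <->
  d a <= d b + k.
Proof.
move=> D; have [la Ha <-] := D a; have [lb Hb <-] := D b.
split=> [[la' [lb' [Ha' Hb']]]|le]; last by exists la, lb.
by rewrite (npred_size Ha Ha') (npred_size Hb Hb').
Qed.

Lemma sat_cmpN k h E d l x y a b : st h E l -> degree E d -> l + 6 <= K -> x <> y ->
  var h x a -> var h y b ->
  sat s h (FCmp k l x y) <-> cmpok E a b /\ d a <= d b + k.
Proof.
move=> S D lK nxy Vx Vy; apply: (iff_trans (sat_cmp k S lK nxy Vx Vy)).
by apply: and_iff_compat => //; apply: degree_le.
Qed.

Section Numbers.
Variables (h : heap) (E : rel nat) (d : nat -> nat) (l x y a b : nat).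
Hypotheses (S : st h E l) (D : degree E d) (lK : l + 6 <= K) (nxy : x <> y).
Hypotheses (Vx : var h x a) (Vy : var h y b).

Lemma sat_eqN : sat s h (FEqN l x y) <->
  a = b \/ [/\ cmpok E a b, cmpok E b a & d a = d b].
Proof.
have nyx : y <> x by move=> /esym.
rewrite sat_or sat_and (sat_aeq nxy Vx Vy) (sat_cmpN _ S D lK nxy Vx Vy).
rewrite (sat_cmpN _ S D lK nyx Vy Vx) !addn0.
split=> -[|[]]; auto.
  by move=> [? ?] [? ?]; right; split=> //; apply/eqP; rewrite eqn_leq; apply/andP.
by move=> ? ? e; right; rewrite e; split; split.
Qed.

Lemma sat_succN : sat s h (FSuccN l x y) <-> cmpok E b a /\ d b = (d a).+1.
Proof.
have nyx : y <> x by move=> /esym.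
rewrite sat_and sat_neg !(sat_cmpN _ S D lK nyx Vy Vx) addn0 addn1.
split=> [[[ok le] N]|[ok e]].
  by split=> //; apply/eqP; rewrite eqn_leq le ltnNge; apply/negP => le'; apply: N.
by rewrite e ltnn; split=> // -[].
Qed.

Lemma sat_zeroN : sat s h (FZeroN l x) <-> d a = 1.
Proof.
have Hx := var_lt S Vx; have [la [ua Ha] <-] := D a.
apply: (@iff_trans _ (exists2 u, ~~ hid u & E u a /\
  forall v, ~~ hid v -> E v a -> u = v)); first by rewrite /FZeroN; fosem.
split=> [[u nu [Eu H]]|].
  have sub : {subset la <= [:: u]}.
    by move=> v; rewrite Ha inE => Ev; apply/eqP/esym/H => //; have [] := st_hid S Ev.
  have := uniq_leq_size ua sub; move: Eu; rewrite -Ha; by case: (la) => [|? []].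
case: (la) Ha => [|u []] // Ha _.
have Eu : E u a by rewrite -Ha mem_head.
exists u; first by have [] := st_hid S Eu.
by split=> // v _; rewrite -Ha inE => /eqP.
Qed.

Lemma sat_posN : sat s h (FPosN l x) <-> 1 < d a.
Proof.
have Hx := var_lt S Vx; have [la [ua Ha] <-] := D a.
apply: (@iff_trans _ (exists2 u, ~~ hid u & exists2 v, ~~ hid v &
  (E u a /\ E v a) /\ u <> v)); first by rewrite /FPosN; fosem.
split=> [[u _ [v _ [[Eu Ev] n]]]|].
  apply: (@uniq_leq_size _ [:: u; v]); first by rewrite /= inE andbT; apply/eqP.
  by move=> w; rewrite !inE Ha => /orP[]/eqP ->.
case: (la) Ha ua => [|u [|v l']] // Ha /= /andP[nu _] _.
have Eu : E u a by rewrite -Ha mem_head.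
have Ev : E v a by rewrite -Ha !inE eqxx orbT.
exists u; first by have [] := st_hid S Eu.
exists v; first by have [] := st_hid S Ev.
by split=> // uv; rewrite uv inE eqxx in nu.
Qed.

End Numbers.

(* The entries sit at distance 3, 5, 7, ... from the start of a fact: then no
   entry is a predecessor of another one, and the predecessors outside the
   chain do not start paths as long as the whole chain. *)
Definition argpos i := i.*2 + 3.

(** The meaning of a constraint in the graph, with the side conditions of the comparisons. Degrees
    exceed entries by one, so a zero entry is a node of degree 1. *)
Definition eholds (E : rel nat) (d : nat -> nat) (env : nat -> nat) c :=
  match c with
  | CEq x i y j => exists2 t, epath E (argpos i) (env x) t &
      exists2 u, epath E (argpos j) (env y) u &
        t = u \/ [/\ cmpok E t u, cmpok E u t & d t = d u]
  | CSucc x i y j => exists2 t, epath E (argpos i) (env x) t &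
      exists2 u, epath E (argpos j) (env y) u & cmpok E u t /\ d u = (d t).+1
  | CZero x i => exists2 t, epath E (argpos i) (env x) t & d t = 1
  | CPos x i => exists2 t, epath E (argpos i) (env x) t & 1 < d t
  end.

Definition FConstr l c :=
  match c with
  | CEq x i y j => FEx l (FAnd (FPath (argpos i) l.+1 (x + 2) l)
      (FEx l.+1 (FAnd (FPath (argpos j) l.+2 (y + 2) l.+1) (FEqN l.+2 l l.+1))))
  | CSucc x i y j => FEx l (FAnd (FPath (argpos i) l.+1 (x + 2) l)
      (FEx l.+1 (FAnd (FPath (argpos j) l.+2 (y + 2) l.+1) (FSuccN l.+2 l l.+1))))
  | CZero x i => FEx l (FAnd (FPath (argpos i) l.+1 (x + 2) l) (FZeroN l.+1 l))
  | CPos x i => FEx l (FAnd (FPath (argpos i) l.+1 (x + 2) l) (FPosN l.+1 l))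
  end.

Lemma epath_last E n a b : epath E n.+1 a b -> exists c, E c b.
Proof.
elim: n a => [|n IH] a /= [c Ec]; first by move=> <-; exists a.
by move=> /IH.
Qed.

Lemma sat_ex_path n h E l x a p (P : nat -> Prop) : st h E l -> l + n < K -> 0 < n ->
  var h x a ->
  (forall t h', st h' E l.+1 -> var h' l t ->
     (forall y b, var h y b -> var h' y b) -> (sat s h' p <-> P t)) ->
  sat s h (FEx l (FAnd (FPath n l.+1 x l) p)) <-> exists2 t, epath E n a t & P t.
Proof.
move=> S lK n0 Vx H; have Hx := var_lt S Vx.
apply: (@iff_trans _ (exists2 t, ~~ hid t & epath E n a t /\ P t)).
  apply: (sat_ex S) => [|c h1 nc S1 V1 M1]; first lia.
  apply: (iff_trans (sat_and _ _ _ _)); apply: and_iff_compat; last exact: H.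
  by apply: sat_path => //; [lia|lia|auto].
split=> [[t _ []]|[t E1 E2]]; exists t => //.
case: n n0 E1 {lK} => // n _ /epath_last[c Ec]; by have [] := st_hid S Ec.
Qed.

Lemma sat_constr h E d l env c : st h E l -> degree E d ->
  l + argpos (entries_of c) + 8 <= K ->
  (forall x, x <= facts_of c -> var h (x + 2) (env x)) ->
  sat s h (FConstr l c) <-> eholds E d env c.
Proof.
move=> S D; have p3 i : 0 < argpos i by rewrite /argpos; lia.
case: c => [x i y j|x i y j|x i|x i]; cbn [facts_of entries_of FConstr eholds] => lK V;
  rewrite /argpos in lK.
- apply: (sat_ex_path S) => //; first by rewrite /argpos; lia.
    by apply: V; lia.
  move=> t h1 S1 V1 M1; apply: (sat_ex_path S1) => //; first by rewrite /argpos; lia.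
    by apply/M1/V; lia.
  by move=> u h2 S2 V2 M2; apply: (sat_eqN S2) => //; (try lia); auto.
- apply: (sat_ex_path S) => //; first by rewrite /argpos; lia.
    by apply: V; lia.
  move=> t h1 S1 V1 M1; apply: (sat_ex_path S1) => //; first by rewrite /argpos; lia.
    by apply/M1/V; lia.
  by move=> u h2 S2 V2 M2; apply: (sat_succN S2) => //; (try lia); auto.
- apply: (sat_ex_path S) => //; first by rewrite /argpos; lia.
    exact: V.
  by move=> t h1 S1 V1 M1; apply: (sat_zeroN S1) => //; lia.
- apply: (sat_ex_path S) => //; first by rewrite /argpos; lia.
    exact: V.
  by move=> t h1 S1 V1 M1; apply: (sat_posN S1) => //; lia.
Qed.

Fixpoint FPrem n D l p :=
  if n is n'.+1 then FEx l (FAnd (FChain D l.+1 l) (FPrem n' D l.+1 p)) else p.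

(** Variable 2 holds the conclusion and the premises start at 3: the fact of index x is the variable
    x + 2. *)
Definition FRule D (r : rule) :=
  let n := rule_facts r in FPrem n D 3 (FBigAnd [seq FConstr (3 + n) c | c <- r]).

Definition fact E D p := exists b, epath E D p b.

Lemma fact_hid h E l D p : st h E l -> 0 < D -> fact E D p -> ~~ hid p.
Proof. by case: D => // D S _ [b [c Ec _]]; have [] := st_hid S Ec. Qed.

Definition erule E d D p (r : rule) := exists env : nat -> nat,
  [/\ env 0 = p, forall i, fact E D (env i) & forall c, c \in r -> eholds E d env c].

Lemma eq_eholds E d env env' c : (forall x, x <= facts_of c -> env x = env' x) ->
  eholds E d env c -> eholds E d env' c.
Proof.
by case: c => [x i y j|x i y j|x i|x i] /= H; rewrite !H // ?leq_maxl ?leq_maxr.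
Qed.

Lemma sat_prem h E d D n l (r : rule) env : st h E l -> degree E d ->
  (forall c, c \in r -> facts_of c + 2 < l + n) ->
  (forall c, c \in r -> l + n + argpos (entries_of c) + 8 <= K) -> 2 < l ->
  l + n + D <= K -> 0 < D -> (forall i, i + 2 < l -> var h (i + 2) (env i) /\ fact E D (env i)) ->
  sat s h (FPrem n D l (FBigAnd [seq FConstr (l + n) c | c <- r])) <->
  exists env', [/\ forall i, i + 2 < l -> env' i = env i, forall i, fact E D (env' i) &
    forall c, c \in r -> eholds E d env' c].
Proof.
move=> + Dg; elim: n h l env => [|n IH] h l env S Hf He l2 lK D0 V.
  rewrite /FPrem sat_bigand addn0.
  have Hc c : c \in r -> (sat s h (FConstr l c) <-> eholds E d env c).
    move=> cr; apply: sat_constr => //; first by rewrite -{1}[l]addn0 He.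
    by move=> x xc; apply: (V x _).1; have := Hf c cr; lia.
  split=> [H|[env' [E1 E2 H]] c cr].
    (* Indices without a variable must also denote facts; the conclusion serves as default. *)
    exists (fun i => if i + 2 < l then env i else env 0); split.
    - by move=> i ->.
    - by move=> i; case: ifP => [/V[]|_] //; apply: (V 0 _).2; lia.
    move=> c cr; have := (Hc c cr).1 (H c cr); apply: eq_eholds => x xc.
    by rewrite ifT //; have := Hf c cr; lia.
  apply/Hc => //; apply: eq_eholds (H c cr) => x xc; apply: E1.
  by have := Hf c cr; lia.
have -> : FPrem n.+1 D l (FBigAnd [seq FConstr (l + n.+1) c | c <- r]) =
  FEx l (FAnd (FChain D l.+1 l) (FPrem n D l.+1
    (FBigAnd [seq FConstr (l.+1 + n) c | c <- r]))) by rewrite addSnnS.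
pose upd c i := if i + 2 == l then c else env i.
apply: (@iff_trans _ (exists2 c, ~~ hid c & fact E D c /\
  exists env', [/\ forall i, i + 2 < l.+1 -> env' i = upd c i,
    forall i, fact E D (env' i) & forall c, c \in r -> eholds E d env' c])).
  apply: (sat_ex S) => [|c h1 nc S1 V1 M1]; first lia.
  apply: (iff_trans (sat_and _ _ _ _)); apply: and_iff_compat_dep => [|Fc].
    by apply: sat_chain => //; lia.
  apply: IH => //; try lia; try (by move=> c' cr; rewrite addSnnS; auto).
  move=> i Hi; rewrite /upd; case: eqP => [->|n0] //.
  by have [|? ?] := V i; [lia|split; auto].
split=> [[c nc [Fc [env' [E1 E2 H]]]]|[env' [E1 E2 H]]].
  exists env'; split=> // i Hi; rewrite E1 /upd; last lia.
  by case: eqP => //; lia.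
have El : l - 2 + 2 = l by lia.
exists (env' (l - 2)); first by apply: fact_hid S _ (E2 _).
split=> //; exists env'; split=> // i Hi; rewrite /upd; case: eqP => [e|n0].
  by congr env'; lia.
by apply: E1; lia.
Qed.

Lemma leq_bigmax_in (T : eqType) (l : seq T) (F : T -> nat) x :
  x \in l -> F x <= \max_(y <- l) F y.
Proof. by move=> xl; rewrite (big_rem x) //= leq_maxl. Qed.

Lemma sat_rule h E d D (r : rule) p : st h E 3 -> degree E d ->
  rule_facts r + argpos (rule_entries r) + 11 <= K -> 3 + rule_facts r + D <= K -> 0 < D ->
  var h 2 p -> fact E D p -> sat s h (FRule D r) <-> erule E d D p r.
Proof.
move=> S Dg K1 K2 D0 V F.
apply: (iff_trans (@sat_prem h E d D (rule_facts r) 3 r (fun=> p) S Dg _ _ _ _ _ _)) => //.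
- by move=> c cr; have := leq_bigmax_in facts_of cr; rewrite -/(rule_facts r); lia.
- move=> c cr; have := leq_bigmax_in entries_of cr; rewrite -/(rule_entries r).
  by move: K1; rewrite /argpos; lia.
- by case=> // i; lia.
split=> -[env [E1 E2 E3]]; exists env; split=> //; first exact: (E1 0).
by case=> // i; lia.
Qed.

Definition FClause D (cl : clause) :=
  FAll 2 (FImp (FChain D 3 2) (FImp (FConstr 3 (CZero 0 cl.1))
    (FBigOr [seq FRule D r | r <- cl.2]))).

Lemma sat_clause h E d D cl : st h E 2 -> degree E d -> 0 < D ->
  (forall r, r \in cl.2 -> rule_facts r + argpos (rule_entries r) + 11 <= K) ->
  (forall r, r \in cl.2 -> 3 + rule_facts r + D <= K) ->
  3 + D <= K -> argpos cl.1 + 11 <= K ->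
  sat s h (FClause D cl) <->
  forall p, fact E D p -> eholds E d (fun=> p) (CZero 0 cl.1) ->
    exists2 r, r \in cl.2 & erule E d D p r.
Proof.
move=> S Dg D0 K1 K2 K3 K4.
apply: (@iff_trans _ (forall p, ~~ hid p -> fact E D p ->
  eholds E d (fun=> p) (CZero 0 cl.1) -> exists2 r, r \in cl.2 & erule E d D p r)).
  apply: (sat_all S) => [|p h1 np S1 V1 M1]; first lia.
  rewrite sat_imp (@sat_chain D h1 E 3 2 p) //; last lia.
  have Z : sat s h1 (FConstr 3 (CZero 0 cl.1)) <-> eholds E d (fun=> p) (CZero 0 cl.1).
    by apply: sat_constr => //; [cbn [entries_of]; lia|case].
  rewrite sat_imp sat_bigor Z {Z}.
  split=> H F; have {}H := H F; move=> Z; case: (H Z) => r rl Hr; exists r => //.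
    by apply/(@sat_rule h1 E d D r p) => //; [apply: K1|apply: K2].
  by apply/(@sat_rule h1 E d D r p) => //; [apply: K1|apply: K2].
split=> H p; last by move=> _; apply: H.
by move=> F; apply: H => //; apply: fact_hid S D0 F.
Qed.

(** [FPto 3 0] identifies the node of the entry [i] with [s 0]; this is the link to [FIn]. *)
Definition FInit D t i :=
  FEx 2 (FAnd (FChain D 3 2) (FAnd (FConstr 3 (CZero 0 t))
    (FEx 3 (FAnd (FPath (argpos i) 4 2 3) (FPto 3 0))))).

Lemma sat_init h E d D t i : st h E 2 -> degree E d -> 0 < D -> 3 + D <= K ->
  argpos t + 11 <= K -> argpos i + 11 <= K ->
  sat s h (FInit D t i) <-> exists p, [/\ fact E D p,
    eholds E d (fun=> p) (CZero 0 t) & epath E (argpos i) p (s 0)].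
Proof.
move=> S Dg D0 K1 K2 K3.
apply: (@iff_trans _ (exists2 p, ~~ hid p & fact E D p /\
    (eholds E d (fun=> p) (CZero 0 t) /\ exists2 u, epath E (argpos i) p u & u = s 0))).
  apply: (sat_ex S) => [|p h1 np S1 V1 M1]; first lia.
  rewrite sat_and (@sat_chain D h1 E 3 2 p) //; last lia.
  have Z : sat s h1 (FConstr 3 (CZero 0 t)) <-> eholds E d (fun=> p) (CZero 0 t).
    by apply: sat_constr => //; [cbn [entries_of]; lia|case].
  rewrite sat_and Z {Z}.
  rewrite (@sat_ex_path (argpos i) h1 E 3 2 p _ (fun u => u = s 0)) //.
  - by lia.
  - by rewrite /argpos; lia.
  by move=> u h2 S2 [_ E2 _] _; rewrite /= E2; split=> [[]|->].
split=> [[p _ [F [Z [u Pu Eu]]]]|[p [F Z P]]]; first by exists p; rewrite -Eu.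
by exists p; [apply: fact_hid S D0 F|split=> //; split=> //; exists (s 0)].
Qed.

Lemma hid_free h E u v : st h E 2 -> h.[? u] = Some v -> ~~ hid u.
Proof.
move=> [_ h1 F _] Eu; apply/negP => /hidP[i Hi e]; rewrite {}e in Eu.
case: (ltngtP i 1) => [|lt|e]; first lia.
  by rewrite F // in Eu; lia.
by rewrite e h1 in Eu.
Qed.

Lemma argposS i : exists n, argpos i = n.+1.
Proof. by exists (i.*2 + 2); rewrite /argpos addnS. Qed.

(** * From a heap satisfying the clauses to a closed set of facts *)

Section Soundness.
Variables (h : heap) (E : rel nat).
Hypothesis S : st h E 2.

Let next u := odflt 0 h.[? u].
Let deg a := size (predl h a).

Lemma degree_predl : degree E deg.
Proof. by move=> a; exists (predl h a) => //; apply: npred_predl S. Qed.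

(** The edge by which the path from [p] arrives is not counted. *)
Definition entry p i := (deg (iter (argpos i) next p)).-1.

Lemma epath_iter n a b : epath E n a b -> iter n next a = b.
Proof.
elim: n a => [|n IH] a //= [c Ec /IH <-]; rewrite -iterS iterSr /next.
by move: Ec; have [_ _ _ <-] := S => /visP[_ _ _ ->].
Qed.

Lemma epath_deg n a b : epath E n.+1 a b -> 0 < deg b.
Proof.
case/epath_last=> c Ec; have [l [_ Hl] <-] := degree_predl b.
by case: l Hl => // /(_ c); rewrite Ec.
Qed.

Lemma entryE p i t : epath E (argpos i) p t -> deg t = (entry p i).+1.
Proof.
move=> P; rewrite /entry (epath_iter P).
by have [n En] := argposS i; move: P; rewrite En => /epath_deg; case: deg.
Qed.

Lemma eholds_holds env c : eholds E deg env c -> holds entry env c.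
Proof.
case: c => [x i y j|x i y j|x i|x i] /= [t /entryE Pt].
- by case=> u /entryE Pu [e|[_ _ e]]; apply: succn_inj; rewrite -Pt -Pu e.
- by case=> u /entryE Pu [_]; rewrite Pt Pu => -[].
- by rewrite Pt => -[].
- by rewrite Pt.
Qed.

Lemma epath_prefix m n a b : m <= n -> epath E n a b -> exists c, epath E m a c.
Proof.
elim: m n a => [|m IH] [|n] a // le; try by exists a.
by case=> c Ec /(IH n c le)[t Pt]; exists t, c.
Qed.

Variable M : nat.
Let D := argpos M.

Lemma entry0_eholds p t : t <= M -> fact E D p -> entry p t = 0 ->
  eholds E deg (fun=> p) (CZero 0 t).
Proof.
move=> tM [b Pb] e; have [|c Pc] := @epath_prefix (argpos t) D p b _ Pb.
  by rewrite /D /argpos; lia.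
by exists c => //; rewrite (entryE Pc) e.
Qed.

(** In an arbitrary heap constraints translate only from the graph to numbers. This suffices: for
    the hypothesis of a clause, a zero flag, the converse also holds, as no [cmpok] is involved. *)
Lemma closed_entry (cls : seq clause) : (forall cl, cl \in cls -> cl.1 <= M) ->
  (forall cl, cl \in cls -> forall p, fact E D p ->
     eholds E deg (fun=> p) (CZero 0 cl.1) -> exists2 r, r \in cl.2 & erule E deg D p r) ->
  closed (fact E D) entry cls.
Proof.
move=> HM H p Fp cl clp /(entry0_eholds (HM cl clp) Fp) /(H cl clp p Fp).
case=> r rc [env [E1 E2 E3]]; exists r => //; exists env; split=> // c /E3.
exact: eholds_holds.
Qed.

End Soundness.

End FirstOrder.

(** * From a closed set of facts to a graph satisfying the clauses *)

Section Completeness.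
Variables (E : rel nat) (d : nat -> nat) (M N : nat).
Variables (dat : nat -> nat -> nat) (node : nat -> nat -> nat).

Let D := argpos M.
Hypothesis funE : forall u v w, E u v -> E u w -> v = w.
Hypothesis node_path : forall i j, i < N -> j <= D -> epath E j (node i 0) (node i j).
Hypothesis node_fact : forall p, fact E D p -> exists2 i, i < N & p = node i 0.
Hypothesis node_deg : forall i a, i < N -> a <= M -> d (node i (argpos a)) = (dat i a).+1.
Hypothesis node_ok : forall i a j b, i < N -> a <= M -> j < N -> b <= M ->
  node i (argpos a) <> node j (argpos b) -> cmpok E (node i (argpos a)) (node j (argpos b)).

Let argD a : a <= M -> argpos a <= D. Proof. by rewrite /D /argpos; lia. Qed.

Lemma epath_fun n a b c : epath E n a b -> epath E n a c -> b = c.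
Proof.
elim: n a => [|n IH] a /=; first by move=> <-.
by move=> [u Eu Pb] [v Ev Pc]; apply: (IH u) => //; rewrite (funE Eu Ev).
Qed.

Lemma holds_eholds env c : (forall x, env x < N) -> entries_of c <= M ->
  holds dat env c -> eholds E d (fun x => node (env x) 0) c.
Proof.
move=> envN; case: c => [x i y j|x i y j|x i|x i] /=; rewrite ?geq_max.
- move=> /andP[iM jM] H; exists (node (env x) (argpos i)); first by apply: node_path; auto.
  exists (node (env y) (argpos j)); first by apply: node_path; auto.
  case: (node (env x) (argpos i) =P node (env y) (argpos j)) => [|n]; [by left|right].
  by split; [exact: node_ok| apply: node_ok => //; exact: nesym |rewrite !node_deg // H].
- move=> /andP[iM jM] H; exists (node (env x) (argpos i)); first by apply: node_path; auto.
  exists (node (env y) (argpos j)); first by apply: node_path; auto.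
  rewrite !node_deg // H; split=> //; apply: node_ok => // e.
  have := node_deg (envN x) iM; rewrite -e node_deg // H; lia.
- move=> iM H; exists (node (env x) (argpos i)); first by apply: node_path; auto.
  by rewrite node_deg // H.
- move=> iM H; exists (node (env x) (argpos i)); first by apply: node_path; auto.
  by rewrite node_deg.
Qed.

(** By [node_fact] every path of length [D] starts at some [node i 0], so the universal quantifier
    of a clause meets only intended facts. *)
Lemma closed_clause (cls : seq clause) : closed (fun i => i < N) dat cls ->
  (forall cl, cl \in cls -> cl.1 <= M) ->
  (forall cl r c, cl \in cls -> r \in cl.2 -> c \in r -> entries_of c <= M) ->
  forall cl, cl \in cls -> forall p, fact E D p ->
     eholds E d (fun=> p) (CZero 0 cl.1) -> exists2 r, r \in cl.2 & erule E d D p r.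
Proof.
move=> C H1 H2 cl clc p /node_fact[i iN ->] [t Pt dt].
have tE : t = node i (argpos cl.1).
  by apply: epath_fun Pt _; apply: node_path => //; apply/argD/H1.
have e : dat i cl.1 = 0 by apply: succn_inj; rewrite -node_deg ?H1 // -tE.
have [r rc [env [E1 E2 E3]]] := C i iN cl clc e.
exists r => //; exists (fun x => node (env x) 0); split=> [|x|c cr].
- by rewrite E1.
- by exists (node (env x) D); apply: node_path.
exact: (holds_eholds E2 (H2 _ _ _ clc rc cr) (E3 c cr)).
Qed.

End Completeness.

(** * Counting the cells that point to a fixed location *)

Definition FNoIn := FNeg (FSept (FAnd FOne (FAlloc 2)) (FReach 2 2 0)).
Definition FOneIn := FAnd FOne (FNeg FNoIn).

(* Exactly n cells other than s 0 itself point to s 0. *)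
Definition FIn n := iter n (FStar FOneIn) FNoIn.

(** The added cell is at [s 2], so it begins the path, and any other cell pointing to [s 0] can
    complete it. A loop at [s 0] is not seen, in accordance with [vis]. *)
Lemma sat_noin (s : store) (h : heap) : s 2 <> s 0 -> h.[? s 2] = None ->
  sat s h FNoIn <-> forall u, u <> s 0 -> h.[? u] <> Some (s 0).
Proof.
move=> n20 h2; rewrite /FNoIn sat_neg sat_sept_one; split=> [N u n0 Eu|H].
  apply: N; exists (s 2), u; split=> //.
    by apply/sat_alloc; rewrite fnd_cell eqxx.
  have n2 : u <> s 2 by move=> e; rewrite e h2 in Eu.
  apply/sat_reach2; exists u; rewrite !fnd_set eqxx.
  by move/eqP/negbTE: (n2) => ->; split=> //; apply: nesym.
case=> a [b [_ /sat_alloc]]; rewrite fnd_cell; case: eqP => // <- _.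
case/sat_reach2=> c [E1 E2 n1 _ n3]; apply: (H c) => //.
by move: E2; rewrite fnd_set; case: eqP => // e; case: n1.
Qed.

Lemma sat_onein (s : store) (h : heap) : s 2 <> s 0 -> h.[? s 2] = None ->
  sat s h FOneIn <-> exists2 u, u <> s 0 & h = cell u (s 0).
Proof.
move=> n20 h2; rewrite sat_and sat_one size_domf1 sat_neg sat_noin //.
split=> [[[a [b e]] N]|[u n0 e]]; last first.
  split; first by exists u, (s 0).
  by move=> /(_ u n0); rewrite e fnd_cell eqxx.
have [u [n0]] : exists u, u <> s 0 /\ h.[? u] = Some (s 0).
  by apply: NNPP => N'; apply: N => u n0 Eu; apply: N'; exists u.
rewrite e fnd_cell; case: eqP => // ua [->]; exists a => //.
by rewrite -ua.
Qed.

Lemma sat_in (s : store) (h : heap) n : s 2 <> s 0 -> h.[? s 2] = None -> sat s h (FIn n) <->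
  exists l, [/\ uniq l, size l = n & forall u, u \in l <-> u <> s 0 /\ h.[? u] = Some (s 0)].
Proof.
move=> n20; elim: n h => [|n IH] h h2.
  apply: (iff_trans (sat_noin n20 h2)); split=> [H|[l [_ /size0nil -> H]] u n0 Eu].
    by exists [::]; split=> // u; split=> // -[/H].
  by have : u \in [::] by apply/H.
apply: (iff_trans (sat_star _ _ _ _)).
have fh P : (filterf h P).[? s 2] = None by rewrite fnd_filterf h2; case: ifP.
split=> [[P []]|[l0 []]].
  rewrite sat_onein // => -[u n0 e] /IH[|l [ul sl H]] //.
  have [Pu Eu] : P u /\ h.[? u] = Some (s 0).
    by apply/fnd_filter_some; rewrite e fnd_cell eqxx.
  exists (u :: l); split=> /=; last 2 first.
  - by rewrite sl.
  - move=> v; rewrite inE; split=> [/orP[/eqP -> //|/H[? /fnd_filter_some[]//]]|[v0 Ev]].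
    case: (boolP (P v)) => Pv; apply/orP; [left|right].
      have : (filterf h P).[? v] = Some (s 0) by apply/fnd_filter_some.
      by rewrite e fnd_cell; case: eqP.
    by apply/H; split=> //; apply/fnd_filter_some.
  by rewrite ul andbT; apply/negP => /H[_ /fnd_filter_some[/=]]; rewrite Pu.
case: l0 => [|u l] //= /andP[nu ul] [sl] H.
have [n0 Eu] : u <> s 0 /\ h.[? u] = Some (s 0) by apply/H; rewrite mem_head.
exists (pred1 u); split.
  apply/(sat_onein n20 (fh _)); exists u => //; apply/fmapP => v.
  by rewrite fnd_filterf fnd_cell /=; case: eqP => [->|].
apply/(IH _ (fh _)); exists l; split=> // v; split=> [vl|[v0 /fnd_filter_some[/= vu Ev]]].
  have [v0 Ev] : v <> s 0 /\ h.[? v] = Some (s 0) by apply/H; rewrite inE vl orbT.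
  split=> //; apply/fnd_filter_some; split=> //=; apply: contra nu => /eqP <-.
  exact: vl.
by have /H : v <> s 0 /\ h.[? v] = Some (s 0) by []; rewrite inE (negbTE vu).
Qed.

Definition FDistinct n := FBigAnd [seq FNeg (FEq p.1 p.2) |
  p <- [seq (i, j) | i <- iota 0 n.+1, j <- iota 0 n.+1] & p.1 != p.2].

Lemma sat_distinct s h n : sat s h (FDistinct n) <->
  forall i j, i <= n -> j <= n -> s i = s j -> i = j.
Proof.
rewrite sat_bigand; split=> [H i j Hi Hj e|H [i j]].
  apply/eqP; apply: contraT => nij; case: (H (i, j)) => //.
  by rewrite mem_filter nij; apply/allpairsP; exists (i, j); rewrite !mem_iota; split=> //; lia.
rewrite mem_filter => /andP[nij /allpairsP[p []]].
rewrite !mem_iota => Hi Hj [e1 e2] e; case/eqP: nij; by apply: H => //=; rewrite ?e1 ?e2 -ltnS.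
Qed.

(** * The formula of an inference system *)

Section Program.
Variables (cls : seq clause) (t i : nat).

Let M := maxn (clause_entries cls) (maxn t i).
Let D := argpos M.
(** A generous number of variables: a constraint of a rule with n premises starts at variable 3 + n,
    its paths need at most [D] further ones, and 8 more cover the end points and a comparison. *)
Let K := clause_facts cls + D + 11.

Definition FProg :=
  FAnd (FDistinct K) (FAnd (FFree K 2)
    (FAnd (FBigAnd [seq FClause K D cl | cl <- cls]) (FInit K D t i))).

Lemma clause_bound cl : cl \in cls -> maxn cl.1 (\max_(r <- cl.2) rule_entries r) <= M.
Proof.
move=> clc; apply: leq_trans (leq_maxl _ _).
exact: (leq_bigmax_in (fun cl : clause => maxn cl.1 (\max_(r <- cl.2) rule_entries r)) clc).
Qed.

Lemma tag_bound cl : cl \in cls -> cl.1 <= M.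
Proof. by move=> /clause_bound; rewrite geq_max => /andP[]. Qed.

Lemma entries_bound cl r : cl \in cls -> r \in cl.2 -> rule_entries r <= M.
Proof.
move=> /clause_bound; rewrite geq_max => /andP[_ le] rc.
exact: leq_trans (leq_bigmax_in rule_entries rc) le.
Qed.

Lemma constr_bound cl r c : cl \in cls -> r \in cl.2 -> c \in r -> entries_of c <= M.
Proof.
move=> clc rc cr; apply: leq_trans (entries_bound clc rc); exact: leq_bigmax_in.
Qed.

Lemma facts_bound cl r : cl \in cls -> r \in cl.2 -> rule_facts r <= clause_facts cls.
Proof.
move=> clc rc; apply: leq_trans (leq_bigmax_in rule_facts rc) _.
exact: (leq_bigmax_in (fun cl : clause => \max_(r <- cl.2) rule_facts r) clc).
Qed.

Lemma argpos_le a b : a <= b -> argpos a <= argpos b.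
Proof. by rewrite /argpos; lia. Qed.

(** Quantifying over [d] is harmless since the graph determines the degrees, and it lets each use
    bring its own description of them. *)
Lemma sat_prog s h : sat s h FProg <->
  [/\ forall i j, i <= K -> j <= K -> s i = s j -> i = j, st s K h (vis s K h) 2 &
   forall d, degree (vis s K h) d ->
     (forall cl, cl \in cls -> forall p, fact (vis s K h) D p ->
        eholds (vis s K h) d (fun=> p) (CZero 0 cl.1) ->
        exists2 r, r \in cl.2 & erule (vis s K h) d D p r) /\
     exists p, [/\ fact (vis s K h) D p, eholds (vis s K h) d (fun=> p) (CZero 0 t) &
       epath (vis s K h) (argpos i) p (s 0)]].
Proof.
have K0 : 0 < K by rewrite /K; lia.
have D0 : 0 < D by rewrite /D /argpos; lia.
have DK : 3 + D <= K by rewrite /K; lia.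
have aK a : a <= M -> argpos a + 11 <= K by move/argpos_le; rewrite /K /D; lia.
have tM : t <= M by rewrite /M; lia.
have iM : i <= M by rewrite /M; lia.
rewrite /FProg sat_and sat_distinct sat_and; set E := vis s K h.
have -> : sat s h (FFree K 2) <-> st s K h E 2.
  by rewrite sat_free //; split=> [[h1 F]|[_ h1 F _]].
suff H : (forall i j, i <= K -> j <= K -> s i = s j -> i = j) -> st s K h E 2 ->
   forall d, degree E d -> sat s h (FAnd (FBigAnd [seq FClause K D cl | cl <- cls])
     (FInit K D t i)) <-> (forall cl, cl \in cls -> forall p, fact E D p ->
        eholds E d (fun=> p) (CZero 0 cl.1) ->
        exists2 r, r \in cl.2 & erule E d D p r) /\
     exists p, [/\ fact E D p, eholds E d (fun=> p) (CZero 0 t) &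
       epath E (argpos i) p (s 0)].
  split=> [[inj [S Hs]]|[inj S Hd]]; first by split=> // d dg; apply/(H inj S d dg).
  split=> //; split=> //.
  have dg := degree_predl S; exact/(H inj S _ dg)/Hd.
move=> inj S d dg; rewrite sat_and sat_bigand; apply: and_iff_compat.
  have Hc cl : cl \in cls -> sat s h (FClause K D cl) <-> forall p, fact E D p ->
        eholds E d (fun=> p) (CZero 0 cl.1) ->
        exists2 r, r \in cl.2 & erule E d D p r.
    move=> clc; apply: sat_clause => //; last exact/aK/tag_bound.
      move=> r rc; have /argpos_le := entries_bound clc rc; have := facts_bound clc rc.
      by rewrite /K /D; lia.
    by move=> r rc; have := facts_bound clc rc; rewrite /K /D; lia.
  by split=> H cl clc; apply/(Hc cl clc)/H.
by apply: sat_init => //; apply: aK.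
Qed.

Lemma prog_sound s h n : sat s h FProg -> sat s h (FIn n.+1) ->
  exists (dom : nat -> Prop) dat, closed dom dat cls /\
    exists p, [/\ dom p, dat p t = 0 & dat p i = n].
Proof.
move=> /sat_prog[inj S /(_ _ (degree_predl S))[Hc [p [Fp Zp Pp]]]] Hn.
have K3 : 11 <= K by rewrite /K; lia.
have K0 : 0 < K by lia.
exists (fact (vis s K h) D), (entry s K h); split.
  by apply: (closed_entry K0 S) => //; apply: tag_bound.
exists p; split=> //; first exact: (eholds_holds S Zp).
apply: succn_inj; rewrite -(entryE S Pp).
have n20 : s 2 <> s 0 by move/inj; lia.
have [_ h1 F _] := S; have h2 : h.[? s 2] = None by apply: F; lia.
have [l [ul <- Hl]] := (sat_in n.+1 n20 h2).1 Hn.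
(* [FIn] counts all cells other than [s 0] that point to [s 0], [degree] only visible edges. They
   agree because no hidden location is allocated in this heap and [s 0] is not hidden. *)
have nS := npred_predl (s 0) S; have [l1 Hl1 <-] := degree_predl S (s 0).
apply: (npred_size Hl1); split=> // u; apply/idP/idP => [/Hl[u0 Eu]|].
  apply/visP; split=> //; first exact: (hid_free K0 S Eu).
  by apply/negP => /(hidP _ K0 _)[j Hj /inj]; lia.
by move=> /visP[_ _ u0 Eu]; apply/Hl.
Qed.

End Program.

(** * A heap representing a finite set of facts *)

Lemma heap_of_pairs (l : seq (nat * nat)) :
  (forall x y z, (x, y) \in l -> (x, z) \in l -> y = z) ->
  exists h : heap, forall x y, h.[? x] = Some y <-> (x, y) \in l.
Proof.
move=> fl; pose f x := head 0 [seq p.2 | p <- l & p.1 == x].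
exists (mkheap f [seq p.1 | p <- l]) => x y; rewrite fnd_mkheap.
have fE z : (x, z) \in l -> f x = z.
  move=> xz; apply: (fl x) => //; rewrite /f.
  have : z \in [seq p.2 | p <- l & p.1 == x].
    by apply/mapP; exists (x, z) => //; rewrite mem_filter eqxx.
  case E: [seq p.2 | p <- l & p.1 == x] => [|y' r] // _.
  have : y' \in [seq p.2 | p <- l & p.1 == x] by rewrite E mem_head.
  by case/mapP=> -[a b]; rewrite mem_filter => /andP[/eqP /= -> H] /= ->.
split=> [|xy]; last by rewrite (fE y xy) ifT //; apply/mapP; exists (x, y).
by case: ifP => // /mapP[[a b] ab /= e] [<-]; subst a; rewrite (fE b ab).
Qed.

Section Model.
Variables (N M : nat) (dat : nat -> nat -> nat).
Let D := argpos M.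

(** Nodes are odd, which leaves the even numbers for the hidden locations. *)
Definition code k x := (cpair k x).*2.+1.
Definition nd i j := code 0 (cpair i j).
Definition mid i a l := code 1 (cpair i (cpair a l)).
Definition tip i a l := code 2 (cpair i (cpair a l)).

Lemma code_inj k x k' x' : code k x = code k' x' -> k = k' /\ x = x'.
Proof. by move=> [] /double_inj /cpair_inj. Qed.

Lemma nd_inj i j i' j' : nd i j = nd i' j' -> i = i' /\ j = j'.
Proof. by case/code_inj=> _ /cpair_inj. Qed.

Lemma leg_inj k i a l i' a' l' :
  code k (cpair i (cpair a l)) = code k (cpair i' (cpair a' l')) -> [/\ i = i', a = a' & l = l'].
Proof. by case/code_inj=> _ /cpair_inj[-> /cpair_inj[-> ->]]. Qed.

(* The fact i is the chain nd i 0, ..., nd i D.  The entry a is the in-degree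
   minus one of nd i (argpos a), whose predecessors besides the chain are the
   nodes mid i a l, each with its own predecessor tip i a l. *)
Definition edge x y :=
  [\/ exists i j, [/\ i < N, j < D, x = nd i j & y = nd i j.+1],
      exists i a l, [/\ i < N, a <= M, l < dat i a & x = mid i a l /\ y = nd i (argpos a)] |
      exists i a l, [/\ i < N, a <= M, l < dat i a & x = tip i a l /\ y = mid i a l]].

Lemma edge_nd i j y : edge (nd i j) y -> [/\ i < N, j < D & y = nd i j.+1].
Proof.
by case=> [[i' [j' [? ? /nd_inj[-> ->] ?]]]|[? [? [? [_ _ _ [/code_inj[]]]]]]
  |[? [? [? [_ _ _ [/code_inj[]]]]]]].
Qed.

Lemma edge_mid i a l y : edge (mid i a l) y ->
  [/\ i < N, a <= M, l < dat i a & y = nd i (argpos a)].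
Proof.
by case=> [[? [? [? ? /code_inj[]]]]|[? [? [? [? ? ? [/leg_inj[-> -> ->] ?]]]]]
  |[? [? [? [_ _ _ [/code_inj[]]]]]]].
Qed.

Lemma edge_tip i a l y : edge (tip i a l) y ->
  [/\ i < N, a <= M, l < dat i a & y = mid i a l].
Proof.
by case=> [[? [? [? ? /code_inj[]]]]|[? [? [? [_ _ _ [/code_inj[]]]]]]
  |[? [? [? [? ? ? [/leg_inj[-> -> ->] ?]]]]]].
Qed.

Lemma edge_to_nd i j x : edge x (nd i j) -> i < N /\
  ((exists2 j', j' < D & x = nd i j' /\ j = j'.+1) \/
   exists a l, [/\ a <= M, l < dat i a, x = mid i a l & j = argpos a]).
Proof.
case=> [[i' [j' [iN jD -> /nd_inj[-> ->]]]]|[i' [a [l [iN aM ld [-> /nd_inj[-> ->]]]]]]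
  |[? [? [? [_ _ _ [_ /code_inj[]]]]]]] //; split=> //.
  by left; exists j'.
by right; exists a, l.
Qed.

Lemma edge_fun x y z : edge x y -> edge x z -> y = z.
Proof.
case=> [[i [j [_ _ -> ->]]]|[i [a [l [_ _ _ [-> ->]]]]]|[i [a [l [_ _ _ [-> ->]]]]]].
- by case/edge_nd.
- by case/edge_mid.
- by case/edge_tip.
Qed.

Lemma edge_neq x y : edge x y -> x <> y.
Proof.
case=> [[i [j [_ _ -> ->]]]|[i [a [l [_ _ _ [-> ->]]]]]|[i [a [l [_ _ _ [-> ->]]]]]].
- by case/nd_inj=> _; lia.
- by case/code_inj.
- by case/code_inj.
Qed.

Lemma edge_odd x y : edge x y -> odd x /\ odd y.
Proof.
by case=> [[i [j [_ _ -> ->]]]|[i [a [l [_ _ _ [-> ->]]]]]|[i [a [l [_ _ _ [-> ->]]]]]];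
  rewrite /nd /mid /tip /code /= !odd_double.
Qed.

Lemma edge_heap : exists h : heap, forall x y, h.[? x] = Some y <-> edge x y.
Proof.
pose ia := [seq (i, a) | i <- iota 0 N, a <- iota 0 M.+1].
pose l := [seq (nd i j, nd i j.+1) | i <- iota 0 N, j <- iota 0 D] ++
  ([seq (mid p.1 p.2 k, nd p.1 (argpos p.2)) | p <- ia, k <- iota 0 (dat p.1 p.2)] ++
   [seq (tip p.1 p.2 k, mid p.1 p.2 k) | p <- ia, k <- iota 0 (dat p.1 p.2)]).
have iaP i a : (i, a) \in ia <-> i < N /\ a <= M.
  split=> [/allpairsP[[i' a'] []]|[iN aM]]; last first.
    by apply/allpairsP; exists (i, a); rewrite !mem_iota; split=> //=; rewrite ?ltnS.
  by rewrite !mem_iota !add0n ltnS => /= iN aM [-> ->].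
have lP x y : (x, y) \in l <-> edge x y.
  rewrite !mem_cat; split=> [/or3P[]|].
  - case/allpairsP=> -[i j] []; rewrite !mem_iota => /= iN jD [-> ->].
    by constructor 1; exists i, j.
  - case/allpairsPdep=> -[i a] [k [/iaP[iN aM]]]; rewrite mem_iota => /= kd [-> ->].
    by constructor 2; exists i, a, k.
  - case/allpairsPdep=> -[i a] [k [/iaP[iN aM]]]; rewrite mem_iota => /= kd [-> ->].
    by constructor 3; exists i, a, k.
  case=> [[i [j [iN jD -> ->]]]|[i [a [k [iN aM kd [-> ->]]]]]|[i [a [k [iN aM kd [-> ->]]]]]];
    apply/or3P.
  - by constructor 1; apply/allpairsP; exists (i, j); rewrite !mem_iota.
  - constructor 2; apply/allpairsPdep; exists (i, a), k; rewrite mem_iota; split=> //.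
    exact/iaP.
  - constructor 3; apply/allpairsPdep; exists (i, a), k; rewrite mem_iota; split=> //.
    exact/iaP.
have [|h Hh] := heap_of_pairs (l := l); first by move=> x y z /lP E1 /lP E2; apply: edge_fun E1 E2.
by exists h => x y; rewrite Hh.
Qed.

Section Edges.
Variable E : rel nat.
Hypothesis EP : forall x y, E x y <-> edge x y.

Lemma nd_path i j n : i < N -> j + n <= D -> epath E n (nd i j) (nd i (j + n)).
Proof.
move=> iN; elim: n j => [|n IH] j le; first by rewrite addn0.
exists (nd i j.+1); last by rewrite -addSnnS; apply: IH; lia.
by apply/EP; constructor 1; exists i, j; split=> //; lia.
Qed.

Lemma nd_path_le i j n t : epath E n.+1 (nd i j) t -> j + n < D.
Proof.
elim: n i j => [|n IH] i j [c /EP/edge_nd[iN jD ->]]; first by rewrite addn0.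
by move=> /IH; lia.
Qed.

(** The longest path that begins outside the chains starts at a [tip] and enters at position 2a + 3,
    so it has D - 1 - 2a edges, fewer than [D]. *)
Lemma nd_fact p : fact E D p -> exists2 i, i < N & p = nd i 0.
Proof.
have [n En] : exists n, D = n.+3 by exists M.*2; rewrite /D /argpos; lia.
case=> b; rewrite {1}En => -[c /EP Ep].
case: (Ep) => [[i [j [iN jD ep ec]]]|[i [a [l [iN aM ld [ep ec]]]]]|[i [a [l [iN aM ld [ep ec]]]]]].
- rewrite ec => /(@nd_path_le _ _ n.+1) le; exists i => //; rewrite ep; congr nd; lia.
- by rewrite ec => /(@nd_path_le _ _ n.+1); rewrite /argpos; lia.
rewrite ec => -[c' /EP/edge_mid[_ _ _ ->] /(@nd_path_le _ _ n)]; rewrite /argpos; lia.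
Qed.

Lemma nd_npred i a : i < N -> a <= M -> npred E (nd i (argpos a))
  (nd i (a.*2 + 2) :: [seq mid i a l | l <- iota 0 (dat i a)]).
Proof.
move=> iN aM; split.
  rewrite /= map_inj_uniq ?iota_uniq ?andbT; last by move=> l l' /leg_inj[].
  by apply/mapP => -[l _ /code_inj[]].
move=> u; rewrite inE; apply/orP/idP => [[/eqP ->|/mapP[l]]|/EP/edge_to_nd[_]].
- by apply/EP; constructor 1; exists i, (a.*2 + 2); rewrite /argpos -addnS /D /argpos; split=> //; lia.
- by rewrite mem_iota => /= ld ->; apply/EP; constructor 2; exists i, a, l.
case=> [[j' jD [-> e]]|[a' [l [aM' ld -> e]]]]; [left|right].
  by apply/eqP; congr nd; rewrite /argpos in e; lia.
have ea : a = a' by rewrite /argpos in e; lia.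
by apply/mapP; exists l; rewrite ?mem_iota ?ea.
Qed.

(** The predecessor of an entry on its chain has position at least 2, hence a predecessor; for the
    other predecessors, the nodes [mid], this is what each [tip] provides. *)
Lemma nd_ok i a j b : i < N -> a <= M -> j < N -> b <= M ->
  nd i (argpos a) <> nd j (argpos b) -> cmpok E (nd i (argpos a)) (nd j (argpos b)).
Proof.
move=> iN aM jN bM n; split=> //.
  case/EP/edge_to_nd=> _ [[j' _ [/nd_inj[_ e1] e2]]|[a' [l [_ _ /code_inj[]]]]] //.
  by rewrite /argpos in e1 e2; lia.
move=> u /EP/edge_to_nd[_] [[j' jD [-> e]]|[a' [l [aM' ld -> e]]]].
  exists (nd i (a.*2 + 1)); apply/EP; constructor 1; exists i, (a.*2 + 1); split=> //.
    by rewrite /D /argpos; lia.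
  by congr nd; rewrite /argpos in e; lia.
by exists (tip i a' l); apply/EP; constructor 3; exists i, a', l.
Qed.

End Edges.
End Model.

Lemma prog_complete (cls : seq clause) t i N dat i0 n :
  closed (fun p => p < N) dat cls -> i0 < N -> dat i0 t = 0 -> dat i0 i = n ->
  exists (s : store) (h : heap), sat s h (FProg cls t i) /\ sat s h (FIn n.+1).
Proof.
move=> C iN Zt Di; set M := maxn (clause_entries cls) (maxn t i).
pose K := clause_facts cls + argpos M + 11.
have tM : t <= M by rewrite /M; lia.
have iM : i <= M by rewrite /M; lia.
have [h hP] := edge_heap N M dat.
(* [s 0] is the node that [FInit] demands; the other variables are even and thus outside the
   graph. *)
pose s x := if x is 0 then nd i0 (argpos i) else x.*2.
have inj : forall x y, x <= K -> y <= K -> s x = s y -> x = y.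
  by case=> [|x] [|y] _ _ //=; rewrite /nd /code; lia.
have hidE u : hid s K u -> ~~ odd u.
  case/mapP=> x; rewrite mem_iota => /andP[x0 _] ->; case: x x0 => // x _.
  by rewrite /= odd_double.
have EP x y : vis s K h x y <-> edge N M dat x y.
  split=> [/visP[_ _ _ /hP]//|Exy]; have [ox oy] := edge_odd Exy.
  apply/visP; split; [by apply/negP => /hidE/negP|by apply/negP => /hidE/negP| |exact/hP].
  exact: edge_neq Exy.
have nofree x : 0 < x -> h.[? s x] = None.
  move=> x0; case E: h.[? s x] => [y|] //; have [+ _] := edge_odd ((hP _ _).1 E).
  by case: x x0 {E} => //= x _; rewrite odd_double.
have S : st s K h (vis s K h) 2 by split=> // [|x Hx]; apply: nofree; lia.
have dn := nd_npred EP iN iM.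
exists s, h; split; last first.
  apply/sat_in; [by move/inj; rewrite /K; lia|exact: nofree|].
  exists (nd i0 (i.*2 + 2) :: [seq mid i0 i l | l <- iota 0 (dat i0 i)]); split.
  - by case: dn.
  - by rewrite /= size_map size_iota Di.
  move=> u; rewrite dn.2 -/(s 0); split=> [/visP[]//|[u0 Eu]].
  exact/EP/hP.
apply/sat_prog; split=> // d dg.
have nd_deg j a : j < N -> a <= M -> d (nd j (argpos a)) = (dat j a).+1.
  move=> jN aM; have [l Hl <-] := dg (nd j (argpos a)).
  by rewrite (npred_size Hl (nd_npred EP jN aM)) /= size_map size_iota.
have nd_path0 j k : j < N -> k <= argpos M -> epath (vis s K h) k (nd j 0) (nd j k).
  by move=> jN; apply: (nd_path EP jN (j := 0)).
have argM a : a <= M -> argpos a <= argpos M by exact: argpos_le.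
split.
  apply: (@closed_clause _ d M N dat nd) => //.
  - by move=> x y z /EP E1 /EP E2; apply: edge_fun E1 E2.
  - exact: nd_fact.
  - exact: nd_ok.
  - exact: tag_bound.
  - exact: constr_bound.
exists (nd i0 0); split; last by apply: nd_path0; auto.
  by exists (nd i0 (argpos M)); apply: nd_path0.
exists (nd i0 (argpos t)); first by apply: nd_path0; auto.
by rewrite nd_deg // Zt.
Qed.

(** * Recursive functions as inference systems *)

Section PrecGraph.
Variables (n : nat) (f : recf n) (g : recf n.+2) (u : n.-tuple nat).

(** Names the fixpoint inside [graph], to which it is convertible, so that induction on the counter
    can be stated. *)
Fixpoint prec_graph (m z : nat) {struct m} : Prop :=
  match m with
  | 0 => graph f u z
  | m'.+1 => exists2 t, prec_graph m' t & graph g [tuple of m' :: t :: u] z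
  end.
End PrecGraph.

Lemma graph_prec n (f : recf n) (g : recf n.+2) v y :
  graph (RPrec f g) v y = prec_graph f g [tuple of behead v] (thead v) y.
Proof. by []. Qed.

(** In [RComp] the arguments get blocks of equal size, the maximum, so that the first tag of each
    block is a closed expression in its index. *)
Fixpoint ntags n (f : recf n) : nat :=
  match f with
  | RZero _ | RSucc | RProj _ _ => 1
  | RComp k _ f g => (ntags f + k * \max_(i < k) ntags (g i)).+1
  | RPrec _ f g => (ntags f + ntags g).+1
  | RMu _ f => (ntags f).+2
  end.

Section Compile.
(* The number of flags; a fact has its result at the entry m and its
   arguments from the entry m+1 on. *)
Variable m : nat.

Definition arg j := m.+1 + j.

Definition eqargs n x (a : nat -> nat) y (b : nat -> nat) : rule :=
  [seq CEq x (arg (a j)) y (arg (b j)) | j <- iota 0 n].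

(* For RMu, the auxiliary tag t+1 stands for the facts that f(z, v) is
   positive for all z < y, with arguments y, v. *)
Fixpoint prog n (f : recf n) (t : nat) {struct f} : seq clause :=
  match f with
  | RZero _ => [:: (t, [:: [:: CZero 0 m]])]
  | RSucc => [:: (t, [:: [:: CSucc 0 (arg 0) 0 m]])]
  | RProj _ i => [:: (t, [:: [:: CEq 0 m 0 (arg i)]])]
  | RComp k n f g =>
      let tg i := t.+1 + ntags f + i * \max_(i < k) ntags (g i) in
      (t, [:: [:: CZero 1 t.+1; CEq 1 m 0 m] ++
              flatten [seq [:: CZero (i + 2) (tg i), CEq 1 (arg i) (i + 2) m &
                               eqargs n (i + 2) id 0 id] | i <- iota 0 k]])
      :: prog f t.+1 ++ flatten [seq prog (g i) (tg i) | i <- enum 'I_k]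
  | RPrec n f g =>
      let tf := t.+1 in let tg := t.+1 + ntags f in
      (t, [:: [:: CZero 1 tf, CZero 0 (arg 0), CEq 1 m 0 m & eqargs n 1 id 0 succn];
              [:: CZero 1 t, CZero 2 tg, CSucc 1 (arg 0) 0 (arg 0), CEq 2 (arg 0) 1 (arg 0),
                  CEq 2 (arg 1) 1 m, CEq 2 m 0 m &
                  eqargs n 1 succn 0 succn ++ eqargs n 2 (fun j => j.+2) 0 succn]])
      :: prog f tf ++ prog g tg
  | RMu n f =>
      let tm := t.+1 in let tf := t.+2 in
      [:: (t, [:: [:: CZero 1 tm, CZero 2 tf, CEq 1 (arg 0) 0 m, CEq 2 (arg 0) 0 m,
                      CZero 2 m & eqargs n 1 succn 0 id ++ eqargs n 2 succn 0 id]]),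
          (tm, [:: [:: CZero 0 (arg 0)];
                   [:: CZero 1 tm, CZero 2 tf, CSucc 1 (arg 0) 0 (arg 0),
                       CEq 2 (arg 0) 1 (arg 0), CPos 2 m &
                       eqargs n 1 succn 0 succn ++ eqargs n 2 succn 0 succn]])
        & prog f tf]
  end.

Lemma closed_sub T (dom : T -> Prop) dat (c1 c2 : seq clause) :
  {subset c1 <= c2} -> closed dom dat c2 -> closed dom dat c1.
Proof. by move=> sub C p dp cl /sub; apply: C. Qed.

Lemma closed_head T (dom : T -> Prop) dat t rs cls p :
  closed dom dat ((t, rs) :: cls) -> dom p -> dat p t = 0 ->
  exists2 r, r \in rs & rule_holds dom dat p r.
Proof. by move=> C dp; apply: (C p dp (t, rs)); rewrite mem_head. Qed.

Lemma holds_eqargs T (dat : T -> nat -> nat) env n x a y b :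
  (forall c, c \in eqargs n x a y b -> holds dat env c) <->
  forall j, j < n -> dat (env x) (arg (a j)) = dat (env y) (arg (b j)).
Proof.
split=> [H j jn|H c /mapP[j]].
  by apply: (H (CEq x (arg (a j)) y (arg (b j)))); apply/mapP; exists j; rewrite ?mem_iota.
by rewrite mem_iota => jn -> /=; apply: H.
Qed.

Lemma holds_cons T (dat : T -> nat -> nat) env c (r : rule) :
  (forall c', c' \in c :: r -> holds dat env c') <->
  holds dat env c /\ forall c', c' \in r -> holds dat env c'.
Proof.
split=> [H|[H1 H2] c']; last by rewrite inE => /orP[/eqP->|/H2].
by split=> [|c' cr]; apply: H; rewrite inE ?eqxx ?cr ?orbT.
Qed.

Lemma holds_cat T (dat : T -> nat -> nat) env (r1 r2 : rule) :
  (forall c', c' \in r1 ++ r2 -> holds dat env c') <->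
  (forall c', c' \in r1 -> holds dat env c') /\ forall c', c' \in r2 -> holds dat env c'.
Proof.
split=> [H|[H1 H2] c']; last by rewrite mem_cat => /orP[/H1|/H2].
by split=> c' cr; apply: H; rewrite mem_cat cr ?orbT.
Qed.

(** Induction on [f], with an inner induction on the counter for recursion and minimization. These
    measures replace well-foundedness of the support, which [closed] does not give. *)
Lemma prog_graph T (dom : T -> Prop) dat n (f : recf n) t :
  closed dom dat (prog f t) -> forall p (v : n.-tuple nat), dom p -> dat p t = 0 ->
  (forall j, j < n -> nth 0 v j = dat p (arg j)) -> graph f v (dat p m).
Proof.
elim: {n} f t => [n||n i|k n f IHf g IHg|n f IHf g IHg|n f IHf] t C p v dp pt Hv.
- have [r + [env [E0 _ H]]] := closed_head C dp pt; rewrite inE => /eqP er.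
  by have := H (CZero 0 m); rewrite er inE /= E0 => ->.
- have [r + [env [E0 _ H]]] := closed_head C dp pt; rewrite inE => /eqP er.
  have := H (CSucc 0 (arg 0) 0 m); rewrite er inE /= E0 => -> //.
  by rewrite -Hv // (tuple_eta v).
- have [r + [env [E0 _ H]]] := closed_head C dp pt; rewrite inE => /eqP er.
  have := H (CEq 0 m 0 (arg i)); rewrite er inE /= E0 => -> //.
  by rewrite -Hv // (tnth_nth 0).
- have [r + [env [E0 Ed]]] := closed_head C dp pt; rewrite inE => /eqP ->.
  rewrite holds_cons holds_cons => -[/= z1 [e1 H]].
  pose tg i := t.+1 + ntags f + i * \max_(i < k) ntags (g i).
  have Hi (i : 'I_k) : [/\ dat (env (i + 2)) (tg i) = 0,
      dat (env 1) (arg i) = dat (env (i + 2)) m &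
      forall j, j < n -> dat (env (i + 2)) (arg j) = dat p (arg j)].
    have : forall c, c \in [:: CZero (i + 2) (tg i), CEq 1 (arg i) (i + 2) m &
                               eqargs n (i + 2) id 0 id] -> holds dat env c.
      move=> c cr; apply: H; apply/flatten_mapP; exists (val i) => //.
      by rewrite mem_iota ltn_ord.
    by rewrite !holds_cons holds_eqargs /= E0 => -[? [? ?]].
  exists [tuple dat (env (i + 2)) m | i < k].
    move=> i; rewrite tnth_mktuple; have [zi _ Ai] := Hi i.
    apply: IHg (Ed _) zi _; last by move=> j jn; rewrite Hv // Ai.
    apply: closed_sub C => cl clc; rewrite inE mem_cat; apply/orP; right; apply/orP; right.
    by apply/flatten_mapP; exists i; rewrite ?mem_enum.
  rewrite -E0 -e1; apply: IHf (Ed 1) z1 _.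
    by apply: closed_sub C => cl clc; rewrite inE mem_cat clc orbT.
  move=> j jk; have [_ -> _] := Hi (Ordinal jk).
  by rewrite -[j in LHS]/(val (Ordinal jk)) -tnth_nth tnth_mktuple.
- have Cf : closed dom dat (prog f t.+1).
    by apply: closed_sub C => cl clc; rewrite inE mem_cat clc orbT.
  have Cg : closed dom dat (prog g (t.+1 + ntags f)).
    by apply: closed_sub C => cl clc; rewrite inE mem_cat clc !orbT.
  rewrite graph_prec; set u := [tuple of behead v].
  have Hu j : j < n -> nth 0 u j = dat p (arg j.+1) by move=> jn; rewrite /u /= nth_behead Hv.
  have -> : thead v = dat p (arg 0) by rewrite -Hv // (tuple_eta v).
  (* Stated for all facts with flag [t], since the recursive premise is another such fact, with a
     smaller counter. *)
  suff Hq a q (w : n.-tuple nat) : dat q (arg 0) = a -> dom q -> dat q t = 0 ->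
      (forall j, j < n -> nth 0 w j = dat q (arg j.+1)) -> prec_graph f g w a (dat q m).
    exact: Hq.
  elim: a q w => [|a IH] q w qa dq qt Hw.
  + have [r + [env [E0 Ed]]] := closed_head C dq qt.
    rewrite !inE => /orP[]/eqP ->; rewrite !holds_cons ?holds_cat !holds_eqargs /= E0.
      move=> [z1 [_ [e1 H]]]; rewrite -e1; apply: IHf (Ed 1) z1 _ => // j jn.
      by rewrite Hw // H.
    by move=> [_ [_ [+ _]]]; rewrite qa.
  + have [r + [env [E0 Ed]]] := closed_head C dq qt.
    rewrite !inE => /orP[]/eqP ->; rewrite !holds_cons ?holds_cat !holds_eqargs /= E0.
      by move=> [_ [+ _]]; rewrite qa.
    move=> [z1 [z2 [+ [e1 [e2 [e3 [H1 H2]]]]]]]; rewrite qa => -[ea].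
    exists (dat (env 1) m).
      by apply: IH => // j jn; rewrite Hw // H1.
    rewrite -e3; apply: IHg (Ed 2) z2 _ => // -[|[|j]] jn /=.
    * by rewrite e1.
    * by rewrite e2.
    * by rewrite Hw // H2.
- have Cf : closed dom dat (prog f t.+2).
    by apply: closed_sub C => cl clc; rewrite !inE clc !orbT.
  have [r + [env [E0 Ed]]] := closed_head C dp pt; rewrite inE => /eqP ->.
  rewrite !holds_cons holds_cat !holds_eqargs /= E0 => -[z1 [z2 [e1 [e2 [e3 [H1 H2]]]]]].
  split.
    rewrite -e3; apply: IHf (Ed 2) z2 _ => // -[|j] jn /=; first by rewrite e2.
    by rewrite Hv // H2.
  have Hu j : j < n -> nth 0 v j = dat (env 1) (arg j.+1) by move=> jn; rewrite Hv // H1.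
  suff Hq a q : dat q (arg 0) = a -> dom q -> dat q t.+1 = 0 ->
      (forall j, j < n -> nth 0 v j = dat q (arg j.+1)) ->
      forall z, z < a -> exists s, graph f [tuple of z :: v] s.+1.
    by rewrite -e1; apply: Hq (Ed 1) z1 Hu.
  elim: a q => [|a IH] q qa dq qt Hw z //; rewrite ltnS leq_eqVlt => za.
  have C' : closed dom dat (behead (prog (RMu f) t)).
    by apply: closed_sub C => cl; apply: mem_behead.
  have [r' + [env' [E0' Ed']]] := closed_head C' dq qt.
  rewrite !inE => /orP[]/eqP ->; rewrite !holds_cons ?holds_cat ?holds_eqargs /= E0'.
    by move=> [+ _]; rewrite qa.
  move=> [z1' [z2' [+ [e1' [e2' [H1' H2']]]]]]; rewrite qa => -[ea].
  case/orP: za => [/eqP ->|za]; last first.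
    by apply: (IH (env' 1)) => // j jn; rewrite Hw // H1'.
  exists (dat (env' 2) m).-1; rewrite prednK //.
  apply: IHf (Ed' 2) z2' _ => // -[|j] jn /=; first by rewrite e1'.
  by rewrite Hw // H2'.
Qed.

(** * Converging computations as finite closed sets *)

Definition tfact : eqType := (nat * nat * seq nat)%type.

Definition ttag (x : tfact) := x.1.1.

(** Constraints compare entries with no constant but zero, so a tag below [m] is stored as a row of
    flags, of which just the one at the tag is 0. *)
Definition tdat (x : tfact) i :=
  if i < m then nat_of_bool (i != ttag x) else
  if i == m then x.1.2 else nth 0 x.2 (i - m.+1).

Lemma tdat_res x : tdat x m = x.1.2.
Proof. by rewrite /tdat ltnn eqxx. Qed.

Lemma tdat_arg x j : tdat x (arg j) = nth 0 x.2 j.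
Proof.
rewrite /tdat /arg; case: ifP => [|_]; first lia.
by case: eqP => [|_]; [lia|rewrite addKn].
Qed.

Lemma tdat_tag x t : t < m -> tdat x t = 0 <-> ttag x = t.
Proof. by rewrite /tdat => ->; case: eqP => [->|ne]; split=> // e; case: ne. Qed.

Lemma ntags_gt0 n (f : recf n) : 0 < ntags f.
Proof. by case: f. Qed.

Lemma prog_tags n (f : recf n) t cl : cl \in prog f t -> t <= cl.1 < t + ntags f.
Proof.
elim: {n} f t cl => [n||n i|k n f IHf g IHg|n f IHf g IHg|n f IHf] t cl.
- by rewrite inE => /eqP -> /=; lia.
- by rewrite inE => /eqP -> /=; lia.
- by rewrite inE => /eqP -> /=; lia.
- rewrite inE mem_cat => /or3P[/eqP -> /=|/IHf /=|]; [lia|lia|].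
  case/flatten_mapP=> i _ /IHg /=; have : ntags (g i) <= \max_(i < k) ntags (g i).
    exact: leq_bigmax.
  have := ltn_ord i; set W := \max_(i < k) _; move: (ntags (g i)) => a ik aW.
  have : i * W + W <= k * W by rewrite addnC -mulSn leq_mul.
  lia.
- by rewrite inE mem_cat => /or3P[/eqP -> /=|/IHf /=|/IHg /=]; lia.
- by rewrite !inE => /or3P[/eqP -> /=|/eqP -> /=|/IHf /=]; lia.
Qed.

Lemma supported_mono (S S' : seq tfact) x cls : {subset S <= S'} ->
  supported (fun y => y \in S) tdat x cls -> supported (fun y => y \in S') tdat x cls.
Proof.
move=> sub H cl clc /(H cl clc)[r rc [env [E0 Ed Er]]].
by exists r => //; exists env; split=> // i; apply: sub.
Qed.

Lemma supported_cons T (dom : T -> Prop) dat p t rs cls :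
  (dat p t = 0 -> exists2 r, r \in rs & rule_holds dom dat p r) ->
  supported dom dat p cls -> supported dom dat p ((t, rs) :: cls).
Proof. by move=> H1 H2 cl; rewrite inE => /orP[/eqP ->|/H2]. Qed.

Lemma supported_nth T (dom : T -> Prop) dat p (rs : seq rule) k : k < size rs ->
  rule_holds dom dat p (nth [::] rs k) -> exists2 r, r \in rs & rule_holds dom dat p r.
Proof. by move=> lt H; exists (nth [::] rs k) => //; apply: mem_nth. Qed.

Lemma supported_cat T (dom : T -> Prop) dat p (c1 c2 : seq clause) :
  supported dom dat p c1 -> supported dom dat p c2 -> supported dom dat p (c1 ++ c2).
Proof. by move=> H1 H2 cl; rewrite mem_cat => /orP[/H1|/H2]. Qed.

Lemma supported_other (dom : tfact -> Prop) x n (f : recf n) t : t + ntags f <= m ->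
  ~~ (t <= ttag x < t + ntags f) -> supported dom tdat x (prog f t).
Proof.
move=> le nx cl /prog_tags clt /tdat_tag e; case/negP: nx.
by rewrite e //; lia.
Qed.

Lemma neq_tag (dom : tfact -> Prop) x t (rs : seq rule) : t < m -> ttag x <> t ->
  tdat x t = 0 -> exists2 r, r \in rs & rule_holds dom tdat x r.
Proof. by move=> tm n /(tdat_tag x tm). Qed.

(** The bounds on the tags make the clauses of the other subterms vacuous on [S], so that the sets
    for several subterms can be united. *)
Definition derivable n (f : recf n) t (x : tfact) := exists S : seq tfact,
  [/\ x \in S, forall y, y \in S -> t <= ttag y < t + ntags f &
      forall y, y \in S -> supported (fun z => z \in S) tdat y (prog f t)].

(** An environment needs a fact at every index; beyond the listed premises the conclusion is
    repeated. *)
Definition pick_env (x : tfact) (l : seq tfact) i := nth x (x :: l) i.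

Lemma pick_env_in (S : seq tfact) x l : x \in S -> {subset l <= S} ->
  forall i, pick_env x l i \in S.
Proof.
move=> xS lS i; rewrite /pick_env; case: (ltnP i (size (x :: l))) => [lt|ge].
  by have := mem_nth x lt; rewrite inE => /orP[/eqP ->|/lS].
by rewrite nth_default.
Qed.

Lemma derivable_base n (f : recf n) t (x : tfact) r :
  prog f t = [:: (t, [:: r])] -> ttag x = t ->
  (forall c, c \in r -> holds tdat (fun=> x) c) -> derivable f t x.
Proof.
move=> e xt H; have f0 := ntags_gt0 f; exists [:: x]; split=> [|y|y]; rewrite ?mem_head // inE => /eqP ->.
  by rewrite xt; lia.
rewrite e; apply: supported_cons => // _; exists r; first by rewrite mem_head.
by exists (fun=> x); split=> // i; rewrite mem_head.
Qed.

Lemma derivable_prec n (f : recf n) (g : recf n.+2) t (u : n.-tuple nat) a y :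
  t + ntags (RPrec f g) <= m ->
  (forall v y, graph f v y -> derivable f t.+1 (t.+1, y, val v)) ->
  (forall v y, graph g v y ->
     derivable g (t.+1 + ntags f) (t.+1 + ntags f, y, val v)) ->
  prec_graph f g u a y -> derivable (RPrec f g) t (t, y, a :: u).
Proof.
move=> /= tm IHf IHg; have := ntags_gt0 f; have := ntags_gt0 g => g0 f0.
elim: a y => [|a IH] y /=.
  move=> /IHf [S [xS tS sS]]; pose x : tfact := (t, y, 0 :: u); exists (x :: S); split.
  - by rewrite mem_head.
  - by move=> z; rewrite inE => /orP[/eqP ->|/tS] /=; rewrite /ttag /=; lia.
  move=> z; rewrite inE => /orP[/eqP ->|zS]; last first.
    have zt := tS z zS; apply: supported_cons; first by apply: neq_tag; lia.
    apply: supported_cat; last by apply: supported_other; lia.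
    by apply: supported_mono (sS z zS) => w; rewrite inE orbC => ->.
  apply: supported_cons => [_|]; last first.
    by apply: supported_cat; apply: supported_other; rewrite /ttag /=; lia.
  apply: (supported_nth (k := 0)); rewrite // [nth _ _ _]/=.
  exists (pick_env x [:: (t.+1, y, val u)]); split=> //.
    by apply: pick_env_in => [|w]; rewrite ?mem_head // !inE => /eqP ->; rewrite xS orbT.
  rewrite !holds_cons holds_eqargs /= !tdat_res !tdat_arg.
  split; first by apply/tdat_tag => //; lia.
  by split=> //; split=> // j jn; rewrite !tdat_arg.
case=> b /IH[S1 [x1 t1 s1]] /IHg[S2 [x2 t2 s2]].
pose x : tfact := (t, y, a.+1 :: u).
exists (x :: S1 ++ S2); split.
- by rewrite mem_head.
- move=> z; rewrite inE mem_cat => /or3P[/eqP ->|/t1|/t2] //=; rewrite /ttag /=; lia.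
move=> z; rewrite inE mem_cat => /or3P[/eqP ->|zS|zS]; last first.
- have zt := t2 z zS; apply: supported_cons; first by apply: neq_tag; lia.
  apply: supported_cat; first by apply: supported_other; lia.
  by apply: supported_mono (s2 z zS) => w; rewrite inE mem_cat => ->; rewrite !orbT.
- by apply: supported_mono (s1 z zS) => w; rewrite inE mem_cat => ->; rewrite !orbT.
apply: supported_cons => [_|]; last first.
  by apply: supported_cat; apply: supported_other; rewrite /ttag /=; lia.
apply: (supported_nth (k := 1)); rewrite // [nth _ _ _]/=.
exists (pick_env x [:: (t, b, a :: u); (t.+1 + ntags f, y, [:: a, b & u])]); split=> //.
  apply: pick_env_in => [|w]; rewrite ?mem_head // !inE mem_cat => /orP[]/eqP ->.
    by rewrite x1 orbT.
  by rewrite x2 !orbT.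
rewrite !holds_cons holds_cat !holds_eqargs /= !tdat_res !tdat_arg.
split; first by apply/tdat_tag => //; lia.
split; first by apply/tdat_tag => //; lia.
do 4 (split=> //).
by split=> j jn; rewrite !tdat_arg.
Qed.

(** Induction on the bound: the auxiliary fact for a + 1 rests on the one for a and on a positive
    value of [f] at a. *)
Lemma derivable_mu_aux n (f : recf n.+1) t (v : n.-tuple nat) a :
  t + ntags (RMu f) <= m ->
  (forall v y, graph f v y -> derivable f t.+2 (t.+2, y, val v)) ->
  (forall z, z < a -> exists s, graph f [tuple of z :: v] s.+1) ->
  derivable (RMu f) t (t.+1, 0, a :: v).
Proof.
move=> /= tm IHf; have f0 := ntags_gt0 f; elim: a => [|a IH] Ha.
  pose x : tfact := (t.+1, 0, 0 :: val v).
  exists [:: x]; split=> [|y|y]; rewrite ?mem_head // inE => /eqP ->.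
    by rewrite /ttag /=; lia.
  apply: supported_cons; first by apply: neq_tag; rewrite /ttag /=; lia.
  apply: supported_cons => [_|]; last by apply: supported_other; rewrite /ttag /=; lia.
  apply: (supported_nth (k := 0)); rewrite // [nth _ _ _]/=.
  exists (fun=> x); split=> // [i|c]; rewrite inE // => /eqP -> /=.
  by rewrite tdat_arg.
have [b /IHf[S2 [x2 t2 s2]]] := Ha a (leqnn _).
have [S1 [x1 t1 s1]] := IH (fun z za => Ha z (ltnW za)).
pose x : tfact := (t.+1, 0, a.+1 :: val v).
exists (x :: S1 ++ S2); split.
- by rewrite mem_head.
- by move=> z; rewrite inE mem_cat => /or3P[/eqP ->|/t1|/t2] //=; rewrite /ttag /=; lia.
move=> z; rewrite inE mem_cat => /or3P[/eqP ->|zS|zS]; last first.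
- have zt := t2 z zS; apply: supported_cons; first by apply: neq_tag; lia.
  apply: supported_cons; first by apply: neq_tag; lia.
  by apply: supported_mono (s2 z zS) => w; rewrite inE mem_cat => ->; rewrite !orbT.
- by apply: supported_mono (s1 z zS) => w; rewrite inE mem_cat => ->; rewrite !orbT.
apply: supported_cons; first by apply: neq_tag; rewrite /ttag /=; lia.
apply: supported_cons => [_|]; last by apply: supported_other; rewrite /ttag /=; lia.
apply: (supported_nth (k := 1)); rewrite // [nth _ _ _]/=.
exists (pick_env x [:: (t.+1, 0, a :: val v); (t.+2, b.+1, a :: val v)]); split=> //.
  apply: pick_env_in => [|w]; rewrite ?mem_head // !inE mem_cat => /orP[]/eqP ->.
    by rewrite x1 orbT.
  by rewrite x2 !orbT.
rewrite !holds_cons holds_cat !holds_eqargs /= !tdat_res !tdat_arg.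
split; first by apply/tdat_tag => //; lia.
split; first by apply/tdat_tag => //; lia.
do 3 (split=> //).
by split=> j jn; rewrite !tdat_arg.
Qed.

Lemma derivable_mu n (f : recf n.+1) t (v : n.-tuple nat) y :
  t + ntags (RMu f) <= m ->
  (forall v y, graph f v y -> derivable f t.+2 (t.+2, y, val v)) ->
  graph (RMu f) v y -> derivable (RMu f) t (t, y, val v).
Proof.
move=> tm IHf [/IHf[S2 [x2 t2 s2]] /(derivable_mu_aux tm IHf)[S1 [x1 t1 s1]]].
rewrite /= in tm t1; have f0 := ntags_gt0 f; pose x : tfact := (t, y, val v).
exists (x :: S1 ++ S2); split.
- by rewrite mem_head.
- by move=> z; rewrite inE mem_cat => /or3P[/eqP ->|/t1|/t2] //=; rewrite /ttag /=; lia.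
move=> z; rewrite inE mem_cat => /or3P[/eqP ->|zS|zS]; last first.
- have zt := t2 z zS; apply: supported_cons; first by apply: neq_tag; lia.
  apply: supported_cons; first by apply: neq_tag; lia.
  by apply: supported_mono (s2 z zS) => w; rewrite inE mem_cat => ->; rewrite !orbT.
- by apply: supported_mono (s1 z zS) => w; rewrite inE mem_cat => ->; rewrite !orbT.
apply: supported_cons => [_|]; last first.
  apply: supported_cons; first by apply: neq_tag; rewrite /ttag /=; lia.
  by apply: supported_other; rewrite /ttag /=; lia.
apply: (supported_nth (k := 0)); rewrite // [nth _ _ _]/=.
exists (pick_env x [:: (t.+1, 0, y :: val v); (t.+2, 0, y :: val v)]); split=> //.
  apply: pick_env_in => [|w]; rewrite ?mem_head // !inE mem_cat => /orP[]/eqP ->.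
    by rewrite x1 orbT.
  by rewrite x2 !orbT.
rewrite !holds_cons holds_cat !holds_eqargs /= !tdat_res !tdat_arg.
split; first by apply/tdat_tag => //; lia.
split; first by apply/tdat_tag => //; lia.
do 3 (split=> //).
by split=> j jn; rewrite !tdat_arg.
Qed.

Lemma derivable_comp k n (f : recf k) (g : 'I_k -> recf n) t (v : n.-tuple nat) y :
  t + ntags (RComp f g) <= m ->
  (forall v y, graph f v y -> derivable f t.+1 (t.+1, y, val v)) ->
  (forall i t v y, t + ntags (g i) <= m -> graph (g i) v y ->
     derivable (g i) t (t, y, val v)) ->
  graph (RComp f g) v y -> derivable (RComp f g) t (t, y, val v).
Proof.
move=> /= tm IHf IHg [w Hg /IHf[S1 [x1 t1 s1]]].
set W := \max_(i < k) ntags (g i) in tm *.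
pose tg i := t.+1 + ntags f + i * W.
have tgW (i : 'I_k) : tg i + ntags (g i) <= t.+1 + ntags f + i.+1 * W.
  by rewrite /tg mulSn; have : ntags (g i) <= W := leq_bigmax i; lia.
have tgm (i : 'I_k) : tg i + ntags (g i) <= t + (ntags f + k * W).+1.
  apply: leq_trans (tgW i) _; have : i.+1 * W <= k * W by rewrite leq_mul2r ltn_ord orbT.
  lia.
have tgm' (i : 'I_k) : tg i + ntags (g i) <= m by apply: leq_trans (tgm i) tm.
(* Blocks of tags have stride [W] and length at most [W], so they do not overlap. *)
have tg_ne (i j : 'I_k) z : tg i <= z < tg i + ntags (g i) -> i <> j ->
    ~~ (tg j <= z < tg j + ntags (g j)).
  move=> Hz ij; apply/negP => Hz'; apply: ij; apply: val_inj => /=.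
  have tgj := tgW j; have tgi := tgW i.
  case: (ltngtP i j) => // lt.
    have : i.+1 * W <= j * W by rewrite leq_mul2r lt orbT.
    by rewrite /tg in Hz Hz' tgi *; lia.
  have : j.+1 * W <= i * W by rewrite leq_mul2r lt orbT.
  by rewrite /tg in Hz Hz' tgj *; lia.
have /fin_all_exists[Sg HS] : forall i : 'I_k, exists S : seq tfact,
    [/\ (tg i, tnth w i, val v) \in S, forall y, y \in S -> tg i <= ttag y < tg i + ntags (g i) &
      forall y, y \in S -> supported (fun z => z \in S) tdat y (prog (g i) (tg i))].
  by move=> i; apply: IHg (tgm' i) (Hg i).
pose SS := flatten [seq Sg i | i <- enum 'I_k].
have SSP z : z \in SS <-> exists i, z \in Sg i.
  split=> [/flatten_mapP[i _ zi]|[i zi]]; first by exists i.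
  by apply/flatten_mapP; exists i; rewrite ?mem_enum.
have supp_g z (dom : tfact -> Prop) : (forall i, supported dom tdat z (prog (g i) (tg i))) ->
    supported dom tdat z (flatten [seq prog (g i) (tg i) | i <- enum 'I_k]).
  by move=> H cl /flatten_mapP[i _]; apply: H.
have f0 := ntags_gt0 f.
pose x : tfact := (t, y, val v); exists (x :: S1 ++ SS); split.
- by rewrite mem_head.
- move=> z; rewrite inE mem_cat => /or3P[/eqP ->|/t1|/SSP[i zi]] /=.
  + by rewrite /ttag /=; lia.
  + by lia.
  have [_ /(_ z zi) tz _] := HS i; have := tgm i; rewrite -/W.
  by move: (ttag z) tz => tag; rewrite /tg; lia.
move=> z; rewrite inE mem_cat => /or3P[/eqP ->|zS|/SSP[i zi]]; last first.
- have [_ /(_ z zi) tz sz] := HS i.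
  apply: supported_cons; first by apply: neq_tag; rewrite /tg in tz; lia.
  apply: supported_cat; first by apply: supported_other; rewrite /tg in tz; lia.
  apply: supp_g => j; case: (i =P j) => [<-|ne]; last first.
    by apply: supported_other => //; apply: tg_ne tz ne.
  apply: supported_mono (sz z zi) => w' wS; rewrite inE mem_cat.
  by apply/or3P; constructor 3; apply/SSP; exists i.
- have tz := t1 z zS; apply: supported_cons; first by apply: neq_tag; lia.
  apply: supported_cat.
    by apply: supported_mono (s1 z zS) => w'; rewrite inE mem_cat => ->; rewrite orbT.
  by apply: supp_g => j; apply: supported_other => //; rewrite /tg; lia.
apply: supported_cons => [_|]; last first.
  apply: supported_cat; first by apply: supported_other; rewrite /ttag /=; lia.
  by apply: supp_g => j; apply: supported_other => //; rewrite /ttag /= /tg; lia.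
apply: (supported_nth (k := 0)); rewrite // [nth _ _ _]/=.
pose gf (i : 'I_k) : tfact := (tg i, tnth w i, val v); pose gs := map gf (enum 'I_k).
exists (pick_env x ((t.+1, y, val w) :: gs)); split=> //.
  apply: pick_env_in => [|q]; rewrite ?mem_head // !inE mem_cat => /orP[/eqP ->|/mapP[i _ ->]].
    by rewrite x1 orbT.
  by apply/or3P; constructor 3; apply/SSP; exists i; have [] := HS i.
rewrite !holds_cons /= !tdat_res; split; first by apply/tdat_tag => //; lia.
split=> // c /flatten_mapP[i]; rewrite mem_iota => /= ik.
have gi : pick_env x ((t.+1, y, val w) :: gs) (i + 2) = gf (Ordinal ik).
  rewrite /pick_env addn2 /= (nth_map (Ordinal ik)) ?size_enum_ord //.
  by congr gf; apply: val_inj; rewrite /= nth_enum_ord.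
move: c; rewrite !holds_cons holds_eqargs /= -/W -/(tg i) gi !tdat_res !tdat_arg.
split; first by apply/tdat_tag => //; have := tgm' (Ordinal ik); have := ntags_gt0 (g (Ordinal ik)); rewrite /=; lia.
split; first by rewrite /gf /= (tnth_nth 0).
by move=> j jn; rewrite !tdat_arg.
Qed.

Lemma graph_derivable n (f : recf n) t v y : t + ntags f <= m ->
  graph f v y -> derivable f t (t, y, val v).
Proof.
elim: {n} f t v y => [n||n i|k n f IHf g IHg|n f IHf g IHg|n f IHf] t v y tm.
- move=> /= ->; apply: derivable_base => // c; rewrite inE => /eqP -> /=.
  by rewrite tdat_res.
- move=> /= ->; apply: derivable_base => // c; rewrite inE => /eqP -> /=.
  by rewrite tdat_res tdat_arg /= (tuple_eta v).
- move=> /= ->; apply: derivable_base => // c; rewrite inE => /eqP -> /=.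
  by rewrite tdat_res tdat_arg /= (tnth_nth 0).
- apply: derivable_comp => // v' y'; apply: IHf; move: tm => /=; lia.
- rewrite graph_prec => H; rewrite {1}(tuple_eta v); apply: derivable_prec H => //.
    by move=> v' y'; apply: IHf; move: tm => /=; lia.
  by move=> v' y'; apply: IHg; move: tm => /=; lia.
- by apply: derivable_mu => // v' y'; apply: IHf; move: tm => /=; lia.
Qed.

End Compile.

(** Flag 0 belongs to [g] itself and [arg m 0] is its argument, one less than the in-degree of
    [s 0]. The result is left open, so a heap exists as soon as [g] has any value. *)
Lemma halting_formula (g : recf 1) : exists A, forall n,
  (exists s h, sat s h A /\ sat s h (FIn n.+1)) <-> exists y, graph g [tuple n] y.
Proof.
pose m := ntags g; exists (FProg (prog m g 0) 0 (arg m 0)) => n; split.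
  case=> s [h [/prog_sound H /H[dom [dat [C [p [dp pt pn]]]]]]].
  exists (dat p m); apply: prog_graph C _ _ dp pt _.
  by case=> //; rewrite pn.
case=> y /(@graph_derivable m 1 g 0 _ _ (leqnn _))[S [xS _ sS]].
set x : tfact := (0, y, _) in xS.
apply: (@prog_complete _ _ _ (size S) (fun i => tdat m (nth x S i)) (index x S)).
- move=> i iS cl clc z; have [r rc [env [E0 Ed Er]]] := sS _ (mem_nth x iS) cl clc z.
  (* Index 0 must be [i] itself: [S] may contain duplicates, of which [index] finds only the
     first. *)
  exists r => //; exists (fun j => if j is 0 then i else index (env j) S).
  split=> [//|[|j] //|c cr]; first by rewrite index_mem.
  have nE j : nth x S (if j is 0 then i else index (env j) S) = env j.
    by case: j => [|j]; [rewrite E0|rewrite nth_index].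
  by have := Er c cr; case: c {cr} => [a b a' b'|a b a' b'|a b|a b] /=; rewrite !nE.
- by rewrite index_mem.
- by rewrite nth_index //; apply/tdat_tag => //; apply: ntags_gt0.
- by rewrite nth_index // tdat_arg.
Qed.

(** * Diagonalization *)

Definition computes n (f : recf n) (F : seq nat -> nat) :=
  forall (v : n.-tuple nat) y, graph f v y <-> y = F v.

Lemma eq_computes n (f : recf n) (F G : seq nat -> nat) : (forall v : n.-tuple nat, F v = G v) ->
  computes f F -> computes f G.
Proof. by move=> FG Ff v y; rewrite Ff FG. Qed.

Definition rproj n i : recf n.+1 := RProj (inord i).
Definition comp1 n (f : recf 1) (g : recf n) := RComp f (fun=> g).
Definition comp2 n (f : recf 2) (g1 g2 : recf n) :=
  RComp f (fun i : 'I_2 => if i == ord0 then g1 else g2).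

Lemma computes_proj n i : i <= n -> computes (rproj n i) (fun v => nth 0 v i).
Proof. by move=> le v y /=; rewrite (tnth_nth 0) inordK. Qed.

Lemma computes_succ : computes RSucc (fun v => (head 0 v).+1).
Proof. by move=> v y; rewrite /= (tuple_eta v). Qed.

Lemma computes_comp1 n f (g : recf n) F G : computes f F -> computes g G ->
  computes (comp1 f g) (fun v => F [:: G v]).
Proof.
move=> Ff Gg v y; split=> /= [[w Hw /Ff ->]|->].
  congr F; rewrite (tuple_eta w) /=; congr cons; last by case: w {Hw} => -[|? []].
  by apply/Gg; apply: Hw.
exists [tuple G v]; last exact/Ff.
by move=> i; apply/Gg; rewrite (ord1 i).
Qed.

Lemma computes_comp2 n f (g1 g2 : recf n) F G1 G2 : computes f F -> computes g1 G1 ->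
  computes g2 G2 -> computes (comp2 f g1 g2) (fun v => F [:: G1 v; G2 v]).
Proof.
move=> Ff Gg1 Gg2 v y; split=> /= [[w Hw /Ff ->]|->].
  congr F; have := Hw ord0; have := Hw (@Ordinal 2 1 isT); rewrite /= !(tnth_nth 0) /=.
  by move=> /Gg2 <- /Gg1 <-; case: w {Hw} => -[|? [|? []]].
exists [tuple G1 v; G2 v]; last exact/Ff.
by move=> i; case: (unliftP ord0 i) => [j|] ->; rewrite ?(ord1 j) /=; [apply/Gg2|apply/Gg1].
Qed.

Fixpoint prec_fun (F G : seq nat -> nat) u m :=
  if m is m'.+1 then G [:: m', prec_fun F G u m' & u] else F u.

Lemma computes_prec n (f : recf n) g F G : computes f F -> computes g G ->
  computes (RPrec f g) (fun v => prec_fun F G (behead v) (head 0 v)).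
Proof.
move=> Ff Gg v y; rewrite graph_prec.
have -> : head 0 v = thead v by rewrite (tuple_eta v).
elim: (thead v) y => [|a IH] y /=; first exact: Ff.
split=> [[t /IH -> /Gg ->] //|->].
by exists (prec_fun F G (behead v) a); [apply/IH|apply/Gg].
Qed.

Fixpoint rconst n c : recf n := if c is c'.+1 then comp1 RSucc (rconst n c') else RZero n.

Lemma computes_const n c : computes (rconst n c) (fun=> c).
Proof.
elim: c => [|c IH]; first by [].
exact: (computes_comp1 computes_succ IH).
Qed.

Definition radd : recf 2 := RPrec (rproj 0 0) (comp1 RSucc (rproj 2 1)).

Lemma computes_add : computes radd (fun v => nth 0 v 0 + nth 0 v 1).
Proof.
have := computes_prec (computes_proj (leqnn 0))
  (computes_comp1 computes_succ (@computes_proj 2 1 isT)).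
apply: eq_computes => v; rewrite (tuple_eta v) /=.
by elim: (thead v) => //= a ->; rewrite addSn.
Qed.

(** Triangular numbers, by adding a + 1 to the number for a. *)
Definition rtri : recf 1 := RPrec (RZero 0) (comp2 radd (rproj 1 1) (comp1 RSucc (rproj 1 0))).

Lemma computes_tri : computes rtri (fun v => 'C((head 0 v).+1, 2)).
Proof.
have := computes_prec (f := RZero 0) (F := fun=> 0) (fun _ _ => iff_refl _)
  (computes_comp2 computes_add (@computes_proj 1 1 isT)
    (computes_comp1 computes_succ (@computes_proj 1 0 isT))).
apply: eq_computes => v /=; elim: (head 0 v) => //= a ->.
by rewrite (binS a.+1 1) bin1 addnC.
Qed.

Definition rpair n (f g : recf n) : recf n := comp2 radd (comp1 rtri (comp2 radd f g)) g.

Lemma computes_pair n (f g : recf n) F G : computes f F -> computes g G ->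
  computes (rpair f g) (fun v => cpair (F v) (G v)).
Proof.
move=> Ff Gg; have Ffg := computes_comp2 computes_add Ff Gg.
exact: (computes_comp2 computes_add (computes_comp1 computes_tri Ffg) Gg).
Qed.

(** 6 is the tag of [FStar] in [gnum]; one iteration turns the code of a formula into that of its
    star with the formula of code [d]. *)
Definition riter c d : recf 1 :=
  RPrec (rconst 0 c) (rpair (rconst 2 6) (rpair (rconst 2 d) (rproj 1 1))).

Lemma computes_iter c d :
  computes (riter c d) (fun v => iter (head 0 v) (fun x => cpair 6 (cpair d x)) c).
Proof.
have := computes_prec (@computes_const 0 c) (computes_pair (@computes_const 2 6)
  (computes_pair (@computes_const 2 d) (@computes_proj 1 1 isT))).
apply: eq_computes => v; elim: (head 0 v) => [|a IH] //.
by cbn [prec_fun nth iter]; rewrite IH.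
Qed.

Section Diagonal.
Variables p q : form.

Definition FDiag A n := FNeg (FAnd A (iter n.+1 (FStar p) q)).

Lemma gnum_iter_star n : gnum (iter n (FStar p) q) =
  iter n (fun x => cpair 6 (cpair (gnum p) x)) (gnum q).
Proof. by elim: n => //= n ->. Qed.

Lemma gnum_diag A n : gnum (FDiag A n) =
  cpair 4 (cpair 5 (cpair (gnum A) (gnum (iter n.+1 (FStar p) q)))).
Proof. by []. Qed.

(** 4 and 5 are the tags of [FNeg] and [FAnd]. The single argument is used twice, as the code of a
    formula and as the number that the iterated star expresses. *)
Definition rdiag : recf 1 :=
  rpair (rconst 1 4) (rpair (rconst 1 5)
    (rpair (rproj 0 0) (comp1 (riter (gnum q) (gnum p)) RSucc))).

Lemma computes_diag : computes rdiag (fun v => cpair 4 (cpair 5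
  (cpair (nth 0 v 0) (gnum (iter (head 0 v).+1 (FStar p) q))))).
Proof.
have := computes_pair (@computes_const 1 4) (computes_pair (@computes_const 1 5)
  (computes_pair (computes_proj (leqnn 0))
    (computes_comp1 (computes_iter (gnum q) (gnum p)) computes_succ))).
by apply: eq_computes => v; rewrite gnum_iter_star.
Qed.

(** Abstract in [p] and [q], since of [FIn] only its form as an iterated star matters here. *)
Lemma valid_not_re :
  (forall g : recf 1, exists A, forall n,
     (exists s h, sat s h A /\ sat s h (iter n.+1 (FStar p) q)) <->
     exists y, graph g [tuple n] y) -> ~ form_re valid.
Proof.
move=> H [f Hf]; have [A HA] := H (comp1 f rdiag).
pose a := gnum A; have := Hf (gnum (FDiag A a)).
have -> : (exists y, graph f [tuple gnum (FDiag A a)] y) <->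
    exists y, graph (comp1 f rdiag) [tuple a] y.
  split=> -[y Hy]; exists y.
    exists [tuple gnum (FDiag A a)] => // i; apply/computes_diag.
    by rewrite (ord1 i) (tnth_nth 0) gnum_diag.
  case: Hy => w /(_ ord0) /computes_diag; rewrite (tnth_nth 0) -[nth 0 [tuple a] 0]/a.
  rewrite -gnum_diag => e; suff -> : [tuple gnum (FDiag A a)] = w by [].
  by move: (gnum (FDiag A a)) e => c e; apply: val_inj; case: w e => -[|b []] //= _ ->.
rewrite -HA => VH.
(* Injectivity of the coding turns membership of the code into validity of this very formula. *)
have V : valid (FDiag A a) <-> exists2 phi, gnum (FDiag A a) = gnum phi & valid phi.
  by split=> [V|[phi /gnum_inj <-]] //; exists (FDiag A a).
have : ~ valid (FDiag A a) <-> exists s h, sat s h A /\ sat s h (iter a.+1 (FStar p) q).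
  split=> [N|[s [h sh]] /(_ s h)]; last exact.
  by apply: NNPP => N'; apply: N => s h sh; apply: N'; exists s, h.
tauto.
Qed.

End Diagonal.

Theorem theorem3p13 : ~ form_re valid.
Proof. exact: valid_not_re halting_formula. Qed.
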